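(* The clones $\langle\mathrm{Emb}(\mathbb{Q},betw)\rangle$, $\langle\mathrm{Emb}(\mathbb{Q},circ)\rangle$ and $\langle\mathrm{Emb}(\mathbb{Q},sep)\rangle$ have automatic homeomorphicity: for each such clone $D$ and every countable set $\Omega$, every clone isomorphism from $D$ onto a closed subclone of $\mathcal{O}_\Omega$ is a homeomorphism.
   Context: On $\mathbb{Q}$: $betw(x,y,z)$ iff $x\le y\le z$ or $z\le y\le x$; $circ(x,y,z)$ iff $x\le y\le z$ or $y\le z\le x$ or $z\le x\le y$; $sep(x,y,z,t)$ iff ($circ(x,y,z)\wedge circ(x,t,y)$) or ($circ(x,z,y)\wedge circ(x,y,t)$). For $R$ one of these, $\mathrm{Emb}(\mathbb{Q},R)$ is the monoid of injective maps $\mathbb{Q}\to\mathbb{Q}$ preserving $R$. For a monoid $M$ of unary maps on $\mathbb{Q}$, $\langle M\rangle$ denotes the clone generated by $M$, i.e. the smallest subset of $\mathcal{O}_{\mathbb{Q}}$ containing $M$ and all projections and closed under composition (it consists of the maps $(x_1,\dots,x_n)\mapsto m(x_i)$ with $m\in M$). $\mathcal{O}_A$ is the set of all finitary operations on $A$; a clone isomorphism is a bijection preserving arities, projections and composition. Clones carry the topology of pointwise convergence on each arity (topological sum over arities of the pointwise-convergence topologies). *)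

(* Defs.v *)
From HB Require Import structures.
From mathcomp Require Import all_boot all_order all_algebra.
From mathcomp Require Import all_classical all_reals all_analysis.

Set Implicit Arguments.
Unset Strict Implicit.
Unset Printing Implicit Defensive.

Import Order.TTheory GRing.Theory Num.Theory.

Local Open Scope classical_set_scope.
Local Open Scope ring_scope.

Definition betw (x y z : rat) : bool := (x <= y <= z) || (z <= y <= x).

Definition circ (x y z : rat) : bool :=
  [|| x <= y <= z, y <= z <= x | z <= x <= y].

Definition sep (x y z t : rat) : bool :=
  (circ x y z && circ x t y) || (circ x z y && circ x y t).

Definition Emb3 (R : rat -> rat -> rat -> bool) : set (rat -> rat) :=
  [set f | injective f /\ forall x y z, R x y z -> R (f x) (f y) (f z)].

Definition Emb4 (R : rat -> rat -> rat -> rat -> bool) : set (rat -> rat) :=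
  [set f | injective f /\
    forall x y z t, R x y z t -> R (f x) (f y) (f z) (f t)].

(* A is discrete, also when A = rat, and the operations have the topology of
   pointwise convergence. Arity 0 is allowed. *)
Definition op (A : choiceType) (n : nat) : Type :=
  {ptws ('I_n -> A) -> discrete_topology A}.

Definition proj_op (A : choiceType) n (i : 'I_n) : op A n := fun x => x i.

Definition comp_op (A : choiceType) n m (f : op A n) (g : 'I_n -> op A m) :
  op A m := fun x => f (fun i => g i x).

Definition unary_op (A : choiceType) (h : A -> A) : op A 1 :=
  fun x => h (x ord0).

(* A set of finitary operations, given by its n-ary part for each n. *)
Definition opset (A : choiceType) := forall n, set (op A n).

Definition is_clone (A : choiceType) (C : opset A) : Prop :=
  (forall n (i : 'I_n), C n (proj_op i)) /\
  (forall n m (f : op A n) (g : 'I_n -> op A m),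
     C n f -> (forall i, C m (g i)) -> C m (comp_op f g)).

Definition clone_generated (A : choiceType) (M : set (A -> A)) : opset A :=
  fun n => [set f | forall C : opset A, is_clone C ->
    (forall h, M h -> C 1 (unary_op h)) -> C n f].

(* {n & op A n} carries the topological sum of the topologies of the op A n. *)
Definition closed_opset (A : choiceType) (C : opset A) : Prop :=
  closed [set f : {n & op A n} | C (tag f) (tagged f)].

(* Composition is expressed through k, the element of C with value f(g_0, ...),
   because the elements of C n are operations bundled with a membership proof. *)
Definition clone_isomorphism (A B : choiceType) (C : opset A) (D : opset B)
    (xi : forall n, C n -> D n) : Prop :=
  [/\ forall n, bijective (xi n),
      forall n (i : 'I_n) (p : C n),
        set_val p = proj_op i -> set_val (xi n p) = proj_op i &
      forall n m (f : C n) (g : 'I_n -> C m) (k : C m),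
        set_val k = comp_op (set_val f) (fun i => set_val (g i)) ->
        set_val (xi m k) =
          comp_op (set_val (xi n f)) (fun i => set_val (xi m (g i)))].

Definition homeomorphism (X Y : topologicalType) (f : X -> Y) : Prop :=
  exists g : Y -> X, [/\ cancel f g, cancel g f, continuous f & continuous g].

Definition sum_map (A B : choiceType) (C : opset A) (D : opset B)
    (xi : forall n, C n -> D n) (f : {n & C n}) : {n & D n} :=
  existT (fun n => D n : Type) (tag f) (xi (tag f) (tagged f)).

Definition automatic_homeomorphicity (A : choiceType) (C : opset A) : Prop :=
  forall (Omega : countType) (D : opset Omega) (xi : forall n, C n -> D n),
    is_clone D -> closed_opset D -> clone_isomorphism xi ->
    homeomorphism (sum_map xi).

(* Main.v *)
Require Import Defs.
From mathcomp Require Import all_boot all_order all_algebra.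
From mathcomp Require Import all_classical all_reals all_analysis.
From mathcomp Require Import lra zify.

(** Let [M] be one of the three monoids and [G] its group of units. A clone
    isomorphism onto a clone on [Omega] is determined by an action of [M] on the
    countable set [Omega], and it is a homeomorphism as soon as
    - the image of a point [w] under [m] depends on finitely many values of [m],
    - each value of [m] depends on the images under [m] of finitely many points.

    For [m] in [Aut(Q, <)] the first property is the small index property,
    proved by a diagonal argument: among disjoint sets [X_0, X_1, ...] there is
    one on which the stabilizer of [w] induces all automorphisms supported there;
    commutators then put all automorphisms supported in some subintervals into
    the stabilizer, and germs at cuts and a supremum argument finish the proof.
    It passes from [Aut(Q, <)] to [G] by fixing finitely many further points.

    By closedness of the image clone, the limits of the action of units define an
    endomorphism [phi] of [M] that is the identity on [G]. If [g0] embeds [Q] as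
    [Q * {0}] into the lexicographic product [Q * Q], then every [g0 (f Q)] is the
    fixed point set of an automorphism [a]; from [a g0 f = g0 f] one gets that
    [phi (g0 f)] has values in [g0 (f Q)], which forces [phi] to be the identity.
    Thus [M] acts by limits of units, which is the first property.

    For the second property, the essential points of [w] (those without a
    neighbourhood all of whose automorphisms fix [w]) form a finite set [E w] with
    [E (m w) = m (E w)], and some [E w] is not empty. *)

Set Implicit Arguments.
Unset Strict Implicit.
Unset Printing Implicit Defensive.

Import Order.TTheory GRing.Theory Num.Theory.

Local Open Scope ring_scope.

(** * Automorphisms of the rational order *)

Definition aut (f : rat -> rat) : Prop :=
  (forall x y, x < y -> f x < f y) /\ exists g, cancel f g /\ cancel g f.

(** Choosing a preimage, with default value 0, gives an inverse that depends on [f] alone; it is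
    meaningful only under [aut f]. *)
Definition inv (f : rat -> rat) (y : rat) : rat := xget 0 [set x | f x = y]%classic.

Definition aut_on (X : set rat) (f : rat -> rat) : Prop :=
  aut f /\ forall x, ~ X x -> f x = x.

Definition itv (a b : rat) : set rat := fun x => a < x < b.

Lemma aut_lt f x y : aut f -> (f x < f y) = (x < y).
Proof.
move=> [fi _]; apply/idP/idP; last exact: fi.
move=> h; rewrite ltNge; apply/negP; rewrite le_eqVlt => /orP[/eqP e|/fi].
  by move: h; rewrite e ltxx.
by move=> h'; move: h; rewrite lt_gtF.
Qed.

Lemma aut_le f x y : aut f -> (f x <= f y) = (x <= y).
Proof. by move=> af; rewrite !leNgt aut_lt. Qed.

Lemma invK f : aut f -> cancel f (inv f).
Proof.
move=> [_ [g [fg _]]] x; apply: (can_inj fg).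
by apply: (@xgetPex _ 0 [set z | f z = f x]%classic); exists x.
Qed.

Lemma invVK f : aut f -> cancel (inv f) f.
Proof. by move=> af; have [_ [g [_ gf]]] := af => y; rewrite -[y in LHS]gf invK. Qed.

Lemma aut_inj f : aut f -> injective f.
Proof. by move=> /invK/can_inj. Qed.

Lemma aut_id : aut idfun.
Proof. by split=> //; exists idfun. Qed.

Lemma aut_comp f g : aut f -> aut g -> aut (f \o g).
Proof.
move=> af ag; split=> [x y|]; first by rewrite /= !aut_lt.
exists (inv g \o inv f); split=> x /=; rewrite ?invK ?invVK //.
Qed.

Lemma aut_inv f : aut f -> aut (inv f).
Proof.
move=> af; split=> [x y|]; first by rewrite -[_ < inv f y](aut_lt _ _ af) !invVK.
by exists f; split; [exact: invVK|exact: invK].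
Qed.

Lemma compVK f : aut f -> inv f \o f = idfun.
Proof. by move=> af; apply/funext => x; rewrite /= invK. Qed.

Lemma aut_iter f n : aut f -> aut (iter n f).
Proof.
move=> af; elim: n => [|n IH]; first exact: aut_id.
exact: (aut_comp af IH).
Qed.

Lemma aut_on_aut X f : aut_on X f -> aut f.
Proof. by case. Qed.

Lemma aut_on_sub (X Y : set rat) f : (forall x, X x -> Y x) -> aut_on X f -> aut_on Y f.
Proof. by move=> XY [af fX]; split=> // x nY; apply: fX => /XY. Qed.

Lemma aut_on_id X : aut_on X idfun.
Proof. by split=> //; exact: aut_id. Qed.

Lemma aut_on_comp X f g : aut_on X f -> aut_on X g -> aut_on X (f \o g).
Proof.
move=> [af fX] [ag gX]; split; first exact: aut_comp.
by move=> x nX /=; rewrite gX // fX.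
Qed.

Lemma aut_on_inv X f : aut_on X f -> aut_on X (inv f).
Proof.
move=> [af fX]; split; first exact: aut_inv.
by move=> x nX; rewrite -[x in LHS]fX // invK.
Qed.

Lemma aut_on_iter X f n : aut_on X f -> aut_on X (iter n f).
Proof.
move=> Af; elim: n => [|n IH]; first exact: aut_on_id.
exact: (aut_on_comp Af IH).
Qed.

Lemma aut_on_stable X f x : aut_on X f -> X x -> X (f x).
Proof.
move=> [af fX] Xx; apply: contrapT => nX.
by move: (nX); have /(aut_inj af) -> := fX _ nX.
Qed.

(* Pairwise disjointness alone makes the glued map increasing. *)
Lemma glue_aut (X : nat -> set rat) (a : nat -> rat -> rat) :
  (forall i j x, X i x -> X j x -> i = j) -> (forall n, aut_on (X n) (a n)) ->
  exists g, aut_on (fun x => exists n, X n x) g /\ forall n x, X n x -> g x = a n x.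
Proof.
move=> dX aX.
pose G (b : nat -> rat -> rat) x :=
  if pselect (exists n, X n x) is left e then b (projT1 (cid e)) x else x.
have GE b n x : X n x -> G b x = b n x.
  move=> Xx; rewrite /G; case: pselect => [e|[]]; last by exists n.
  by case: (cid e) => m /= Xm; rewrite (dX _ _ _ Xm Xx).
have GN b x : ~ (exists n, X n x) -> G b x = x.
  by move=> nX; rewrite /G; case: pselect.
have GK b c : (forall n, aut_on (X n) (b n)) -> (forall n, cancel (b n) (c n)) ->
    cancel (G b) (G c).
  move=> bX bc x; case: (pselect (exists n, X n x)) => [[n Xx]|nX]; last first.
    by rewrite [G b x]GN // GN.
  by rewrite (GE _ _ _ Xx) (GE _ n) ?bc //; exact: aut_on_stable (bX n) _.
have an n := aut_on_aut (aX n).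
exists (G a); split; [split; [split|]|].
- move=> x y xy.
  case: (pselect (exists n, X n x)) => [[n Xx]|nX]; last first.
    rewrite [G a x]GN //.
    case: (pselect (exists n, X n y)) => [[m Xy]|nY]; last by rewrite GN.
    rewrite (GE _ _ _ Xy) -[x](aX m).2 ?aut_lt // => Xx.
    by apply: nX; exists m.
  rewrite (GE _ _ _ Xx); case: (pselect (X n y)) => [Xy|nXy].
    by rewrite (GE _ _ _ Xy) aut_lt.
  (* [a n] fixes [y], and in the last case [a m] fixes [a n x], because [a n x] lies in [X n] and
     [y] does not. *)
  have axy : a n x < y by rewrite -[y](aX n).2 // aut_lt.
  case: (pselect (exists n, X n y)) => [[m Xy]|nY]; last by rewrite GN.
  rewrite (GE _ _ _ Xy) -[a n x](aX m).2 ?aut_lt // => Xm.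
  by apply: nXy; rewrite (dX n m (a n x)) //; exact: aut_on_stable (aX n) Xx.
- exists (G (fun n => inv (a n))); split; apply: GK => // n.
  + exact: invK.
  + exact: aut_on_inv.
  + exact: invVK.
- by move=> x; exact: GN.
- by move=> n x; exact: GE.
Qed.

Definition convex (C : set rat) : Prop :=
  forall x y z, C x -> C z -> x <= y <= z -> C y.

(** A point outside [X] is on the same side of [x] and of [g x], since a convex subset of [X]
    contains both. Hence [g] on [X], continued by the identity, is still increasing. *)
Lemma aut_split (g : rat -> rat) (X : set rat) : aut g ->
  (forall x, X x -> exists C : set rat, [/\ C x, forall y, C y -> X y, convex C &
     forall y, C y <-> C (g y)]) ->
  exists g1 g2, [/\ aut_on X g1, aut_on (fun x => ~ X x) g2, g = g1 \o g2,
    forall x, X x -> g1 x = g x & forall x, ~ X x -> g2 x = g x].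
Proof.
move=> ag XC.
have XS x : X x -> X (g x).
  by move=> /XC [C [Cx CX _ Cg]]; exact: CX (proj1 (Cg _) Cx).
have XV x : X x -> X (inv g x).
  by move=> /XC [C [Cx CX _ Cg]]; apply: CX; apply/Cg; rewrite invVK.
have XgE x : X (g x) <-> X x.
  by split=> [/XV|/XS //]; rewrite invK.
have cmp x z : X x -> ~ X z -> (g x < z) = (x < z).
  move=> Xx nXz; have [C [Cx CX cC Cg]] := XC _ Xx.
  have nC : ~ C z by move/CX.
  apply/idP/idP => h; rewrite ltNge; apply/negP => h'.
    by apply: nC; apply: (cC (g x) z x) => //; [exact/(proj1 (Cg _))|rewrite h' (ltW h)].
  by apply: nC; apply: (cC x z (g x)) => //; [exact/(proj1 (Cg _))|rewrite h' (ltW h)].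
pose g1 x := if pselect (X x) is left _ then g x else x.
have g1X x : X x -> g1 x = g x by rewrite /g1; case: pselect.
have g1N x : ~ X x -> g1 x = x by rewrite /g1; case: pselect.
have ag1 : aut g1.
  split.
    move=> x y xy; case: (pselect (X x)) (pselect (X y)) => [Xx|Xx] [Xy|Xy].
    - by rewrite !g1X // aut_lt.
    - by rewrite g1X // g1N // cmp.
    - rewrite g1N // g1X // ltNge le_eqVlt cmp // [y < x]lt_gtF // orbF.
      by apply/eqP => e; apply: Xx; rewrite -e; exact: XS.
    - by rewrite !g1N.
  pose h x := if pselect (X x) is left _ then inv g x else x.
  have hX x : X x -> h x = inv g x by rewrite /h; case: pselect.
  have hN x : ~ X x -> h x = x by rewrite /h; case: pselect.
  exists h; split=> x; case: (pselect (X x)) => Xx.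
  - by rewrite g1X // hX ?invK //; exact: XS.
  - by rewrite g1N // hN.
  - by rewrite hX // g1X ?invVK //; exact: XV.
  - by rewrite hN // g1N.
have Ag1 : aut_on X g1 by split.
have ai := aut_inv ag1.
exists g1, (inv g1 \o g); split=> //.
- split; first exact: aut_comp.
  by move=> x /contrapT Xx /=; rewrite -g1X // invK.
- by apply/funext => x /=; rewrite invVK.
- by move=> x nX /=; rewrite -[g x in LHS]g1N ?invK // XgE.
Qed.

(** * Back and forth *)

(** Density, absence of endpoints and nonemptiness in one condition, in the form in which finite
    partial isomorphisms are extended by a point. *)
Definition saturated d (T : orderType d) : Prop :=
  forall L U : seq T, (forall l u, l \in L -> u \in U -> (l < u)%O) ->
  exists y, (forall l, l \in L -> (l < y)%O) /\ forall u, u \in U -> (y < u)%O.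

Lemma max_seq d (T : orderType d) (s : seq T) :
  s = [::] \/ exists2 m, m \in s & forall x, x \in s -> (x <= m)%O.
Proof.
elim: s => [|a s [->|[m ms IH]]]; [by left|right|right].
  by exists a => [|x]; rewrite inE // => /eqP ->.
case: (leP a m) => am; [exists m|exists a]; rewrite ?inE ?eqxx ?ms ?orbT // => x.
  by rewrite inE => /orP[/eqP -> //|/IH].
by rewrite inE => /orP[/eqP -> //|/IH /le_trans -> //]; exact: ltW.
Qed.

Lemma min_seq d (T : orderType d) (s : seq T) :
  s = [::] \/ exists2 m, m \in s & forall x, x \in s -> (m <= x)%O.
Proof. exact: (@max_seq _ T^d). Qed.

Lemma dense_saturated d (T : orderType d) (x0 : T) :
  (forall x y : T, (x < y)%O -> exists z, (x < z)%O /\ (z < y)%O) ->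
  (forall x : T, exists z, (x < z)%O) -> (forall x : T, exists z, (z < x)%O) ->
  saturated T.
Proof.
move=> den up down L U LU.
case: (max_seq L) (min_seq U) => [->|[m mL mx]] [->|[k kU kn]].
- by exists x0.
- by have [z zk] := down k; exists z; split=> // u /kn; exact: lt_le_trans.
- by have [z zk] := up m; exists z; split=> // u /mx /le_lt_trans; apply.
- have [z [mz zk]] := den _ _ (LU _ _ mL kU); exists z; split=> u.
    by move=> /mx /le_lt_trans; apply.
  by move=> /kn; exact: lt_le_trans.
Qed.

Lemma rat_saturated : saturated rat.
Proof.
apply: (@dense_saturated _ _ (0 : rat)) => [x y xy|x|x].
- exists ((x + y) / 2); split; lra.
- exists (x + 1); lra.
- exists (x - 1); lra.
Qed.


Definition order_preserving d1 d2 (T1 : orderType d1) (T2 : orderType d2)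
    (s : seq (T1 * T2)) : Prop :=
  forall p q, p \in s -> q \in s -> (p.1 < q.1)%O = (p.2 < q.2)%O.

Lemma order_preserving_extend d1 d2 (T1 : orderType d1) (T2 : orderType d2)
    (s : seq (T1 * T2)) (x : T1) :
  saturated T2 -> order_preserving s -> exists y, order_preserving ((x, y) :: s).
Proof.
move=> sat os.
suff [y hy] : exists y, forall p, p \in s ->
    (x < p.1)%O = (y < p.2)%O /\ (p.1 < x)%O = (p.2 < y)%O.
  exists y => p q; rewrite !inE => /orP[/eqP->|ps] /orP[/eqP->|qs] /=.
  - by rewrite !ltxx.
  - by have [] := hy _ qs.
  - by have [] := hy _ ps.
  - exact: os.
have [/hasP[p ps /eqP <-]|/hasPn nx] := boolP (has (fun p => p.1 == x) s).
  by exists p.2 => q qs; split; apply: os.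
have [] := sat [seq p.2 | p <- s & (p.1 < x)%O] [seq p.2 | p <- s & (x < p.1)%O].
  move=> l u /mapP[p]; rewrite mem_filter => /andP[px ps] ->.
  move=> /mapP[q]; rewrite mem_filter => /andP[xq qs] ->.
  by rewrite -os //; exact: lt_trans xq.
move=> y [yL yU]; exists y => p ps.
case: (ltgtP p.1 x) => px; last by have := nx _ ps; rewrite px eqxx.
- have py : (p.2 < y)%O by apply: yL; apply/mapP; exists p; rewrite ?mem_filter ?px.
  by rewrite py lt_gtF.
- have py : (y < p.2)%O by apply: yU; apply/mapP; exists p; rewrite ?mem_filter ?px.
  by rewrite py lt_gtF.
Qed.

Lemma order_preserving_extend_r d1 d2 (T1 : orderType d1) (T2 : orderType d2)
    (s : seq (T1 * T2)) (y : T2) :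
  saturated T1 -> order_preserving s -> exists x, order_preserving ((x, y) :: s).
Proof.
move=> sat os.
have swapP (p : T1 * T2) r : p \in r -> (p.2, p.1) \in [seq (q.2, q.1) | q <- r].
  by move=> pr; apply/mapP; exists p.
have [|x ox] := @order_preserving_extend _ _ _ _ [seq (p.2, p.1) | p <- s] y sat.
  by move=> p q /mapP[p' p's ->] /mapP[q' q's ->] /=; rewrite os.
exists x => p q /swapP ps /swapP qs.
by rewrite (ox (p.2, p.1) (q.2, q.1)).
Qed.

(** The requirements [E n] leave room for diagonal arguments: at stage [n] a finite piece [t]
    witnessing [E n] is added to the partial isomorphism. *)
Lemma back_and_forth d1 d2 (T1 : orderType d1) (T2 : orderType d2)
    (e1 : nat -> T1) (e2 : nat -> T2) (s0 : seq (T1 * T2))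
    (E : nat -> seq (T1 * T2) -> Prop) :
  saturated T1 -> saturated T2 ->
  (forall x, exists n, e1 n = x) -> (forall x, exists n, e2 n = x) ->
  order_preserving s0 ->
  (forall n s, order_preserving s -> {subset s0 <= s} ->
     exists t, order_preserving (t ++ s) /\ E n t) ->
  exists f g, [/\ cancel f g, cancel g f, forall x y, (x < y)%O -> (f x < f y)%O,
    forall p, p \in s0 -> f p.1 = p.2 &
    forall n, exists t, E n t /\ forall p, p \in t -> f p.1 = p.2].
Proof.
move=> sat1 sat2 e1S e2S os0 HE.
(* The invariants are premises of [next], so that one choice function covers all lists. *)
pose next (ns : nat * seq (T1 * T2)) (t : seq (T1 * T2)) :=
  order_preserving ns.2 -> {subset s0 <= ns.2} ->
  [/\ order_preserving t, {subset ns.2 <= t}, exists y, (e1 ns.1, y) \in t,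
    exists x, (x, e2 ns.1) \in t & exists2 u, {subset u <= t} & E ns.1 u].
have [F FP] : {F & forall ns, next ns (F ns)}.
  apply: choice => -[n s]; rewrite /next /=.
  have [os|] := pselect (order_preserving s); last by exists [::].
  have [s0s|] := pselect {subset s0 <= s}; last by exists [::].
  have [y oy] := order_preserving_extend (e1 n) sat2 os.
  have [x ox] := order_preserving_extend_r (e2 n) sat1 oy.
  have [|u [ou Eu]] := HE n _ ox; first by move=> p /s0s ps; rewrite !inE ps !orbT.
  exists (u ++ [:: (x, e2 n), (e1 n, y) & s]) => _ _; split=> //.
  - by move=> p ps; rewrite mem_cat !inE ps !orbT.
  - by exists y; rewrite mem_cat !inE eqxx !orbT.
  - by exists x; rewrite mem_cat !inE eqxx !orbT.
  - by exists u => // p pu; rewrite mem_cat pu.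
pose S := fix S n := if n is m.+1 then F (m, S m) else s0.
have SP n : order_preserving (S n) /\ {subset s0 <= S n}.
  elim: n => [|n [on sn]] /=; first by split.
  have [oF nF _ _ _] := FP (n, S n) on sn.
  by split=> // p /sn /nF.
have SM m n p : (m <= n)%N -> p \in S m -> p \in S n.
  move=> /subnKC <- pm; elim: (n - m)%N => [|k IH]; first by rewrite addn0.
  rewrite addnS /=; have [ok sk] := SP (m + k)%N.
  by have [_ nF _ _ _] := FP ((m + k)%N, S (m + k)%N) ok sk; exact: nF IH.
have SU m n p q : p \in S m -> q \in S n -> (p.1 < q.1)%O = (p.2 < q.2)%O.
  move=> pm qn; have [H _] := SP (maxn m n).
  by apply: H; [exact: SM (leq_maxl _ _) pm|exact: SM (leq_maxr _ _) qn].
have dom x : exists y, exists n, (x, y) \in S n.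
  have [n <-] := e1S x; have [on sn] := SP n.
  by have [_ _ [y yF] _ _] := FP (n, S n) on sn; exists y, n.+1.
have ran y : exists x, exists n, (x, y) \in S n.
  have [n <-] := e2S y; have [on sn] := SP n.
  by have [_ _ _ [x xF] _] := FP (n, S n) on sn; exists x, n.+1.
have [f fP] := choice dom; have [g gP] := choice ran.
have fE n p : p \in S n -> f p.1 = p.2.
  move=> pn; have [m fm] := fP p.1.
  have := SU _ _ _ _ pn fm; have := SU _ _ _ _ fm pn => /=.
  by rewrite !ltxx; case: ltgtP.
have gE n p : p \in S n -> g p.2 = p.1.
  move=> pn; have [m gm] := gP p.2.
  have := SU _ _ _ _ pn gm; have := SU _ _ _ _ gm pn => /=.
  by rewrite !ltxx; case: ltgtP.
exists f, g; split.
- by move=> x; have [n /gE] := fP x.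
- by move=> y; have [n /fE] := gP y.
- move=> x y; have [n fx] := fP x; have [m fy] := fP y.
  by have /= -> := SU _ _ _ _ fx fy.
- by move=> p ps; apply: (fE 0%N).
- move=> n; have [on sn] := SP n.
  have [_ _ _ _ [u uF Eu]] := FP (n, S n) on sn; exists u; split=> // p /uF pF.
  exact: (fE n.+1).
Qed.

Definition enum_rat (n : nat) : rat := odflt 0 (unpickle n).

Lemma enum_ratP x : exists n, enum_rat n = x.
Proof. by exists (pickle x); rewrite /enum_rat pickleK. Qed.

Lemma finite_extension (s : seq (rat * rat)) : order_preserving s ->
  exists g, aut g /\ forall p, p \in s -> g p.1 = p.2.
Proof.
move=> os.
have [|f [g [fg gf fi fs _]]] := back_and_forth (E := fun _ _ => True) rat_saturated
    rat_saturated enum_ratP enum_ratP os.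
  by move=> _ t ot _; exists [::].
by exists f; split=> //; split=> //; exists g.
Qed.

Lemma restrict_itv g a b : aut g -> g a = a -> g b = b ->
  exists k, aut_on (itv a b) k /\ forall x, itv a b x -> k x = g x.
Proof.
move=> ag ga gb.
have [|g1 [g2 [Ag1 _ _ g1E _]]] := @aut_split g (itv a b) ag; last by exists g1.
move=> x xab; exists (itv a b); split=> // [u v w|y]; rewrite /itv.
  by move=> /andP[au _] /andP[_ wb] /andP[uv vw]; rewrite (lt_le_trans au) // (le_lt_trans vw).
by rewrite -[in X in _ <-> X]ga -[in X in _ <-> X]gb !aut_lt.
Qed.

Lemma move_point a b x y : itv a b x -> itv a b y -> exists g, aut_on (itv a b) g /\ g x = y.
Proof.
move=> /[dup] xab /andP[ax xb] /andP[ay yb].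
have [|g [ag gs]] := @finite_extension [:: (a, a); (b, b); (x, y)].
  move=> p q; rewrite !inE => /or3P[] /eqP-> /or3P[] /eqP-> /=;
    rewrite ?ltxx ?(lt_trans ax xb) ?ax ?xb ?ay ?yb //; apply/idP/idP; lra.
have [||k [Ak kE]] := restrict_itv (a := a) (b := b) ag.
- by apply: (gs (a, a)); rewrite !inE eqxx.
- by apply: (gs (b, b)); rewrite !inE eqxx orbT.
by exists k; split=> //; rewrite kE //; apply: (gs (x, y)); rewrite !inE eqxx !orbT.
Qed.

Lemma move_two_points a b x1 x2 y1 y2 : a < x1 -> x1 < x2 -> x2 < b -> a < y1 -> y1 < y2 ->
  y2 < b -> exists g, [/\ aut_on (itv a b) g, g x1 = y1 & g x2 = y2].
Proof.
move=> ax1 x12 x2b ay1 y12 y2b.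
have [||g [Ag gx2]] := @move_point a b x2 y2; [rewrite /itv; lra|rewrite /itv; lra|].
have ga : g a = a by apply: Ag.2; rewrite /itv ltxx.
have ag := aut_on_aut Ag.
(* Once [x2] is in place, the image of [x1] is moved inside [(a, y2)], which leaves [y2] fixed. *)
have [||k [Ak kx1]] := @move_point a y2 (g x1) y1.
- by rewrite /itv -[a in a < _]ga -gx2 !aut_lt // ax1.
- by rewrite /itv ay1.
exists (k \o g); split=> //=.
  by apply: aut_on_comp => //; apply: aut_on_sub Ak => t; rewrite /itv; lra.
by rewrite gx2 Ak.2 // /itv ltxx andbF.
Qed.

(** * The small index property *)

(** As [b] is supported in [X], its conjugate by [h] depends only on the values of [h] on [X]. *)
Lemma conj_local (X : set rat) h a b : aut h -> aut_on X a ->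
  (forall x, X x -> h x = a x) -> aut_on X b -> h \o b \o inv h = a \o b \o inv a.
Proof.
move=> ah Aa ha Ab; have aa := aut_on_aut Aa; have Av := aut_on_inv Aa.
have hX x : X x -> inv h x = inv a x.
  move=> Xx; apply: (aut_inj ah); rewrite invVK // ha ?invVK //.
  exact: aut_on_stable Av Xx.
apply/funext => x /=; case: (pselect (X x)) => Xx.
  by rewrite hX // ha //; apply: (aut_on_stable Ab); exact: aut_on_stable Av Xx.
have nX : ~ X (inv h x).
  move=> Xh; apply: Xx; rewrite -[x](invVK ah) ha //; exact: aut_on_stable Aa Xh.
by rewrite Ab.2 // invVK // Av.2 // Ab.2 // Aa.2.
Qed.

(* The swindle: [a] is a commutator, because the product of all conjugates of
   [a] by powers of [s] differs from its own conjugate by [s] only by [a]. *)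
Lemma swindle (s : rat -> rat) (W : set rat) a : aut s ->
  (forall i x, W x -> ~ W (iter i.+1 s x)) -> aut_on W a ->
  exists b, aut_on (fun x => exists i, W (iter i (inv s) x)) b /\
    a = b \o s \o inv b \o inv s.
Proof.
move=> as_ Ws Aa.
(* [Wi i] is the image of [W] under the [i]-th power of [s]; these images are disjoint because no
   positive power of [s] returns a point of [W] to [W]. *)
pose Wi i : set rat := fun x => W (iter i (inv s) x).
have iterK i : cancel (iter i (inv s)) (iter i s).
  by elim: i => [|i IH] x //; rewrite iterS iterSr IH invVK.
have iterVK i : cancel (iter i s) (iter i (inv s)).
  by elim: i => [|i IH] x //; rewrite iterS iterSr IH invK.
have lt_disj i j x : (i < j)%N -> Wi i x -> Wi j x -> False.
  move=> ij Wix Wjx; apply: (Ws (j - i).-1 _ Wjx).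
  rewrite prednK ?subn_gt0 // -[in iter j](subnK (ltnW ij)) iterD.
  by rewrite [iter (j - i) (inv s) _ in X in iter _ s X]/= iterK.
have disj i j x : Wi i x -> Wi j x -> i = j.
  by move=> Wix Wjx; case: (ltngtP i j) => // /lt_disj /(_ _) H; [case: (H x)|case: (H x)].
have asi := aut_inv as_.
have [|b [Ab bE]] := @glue_aut Wi (fun i => iter i s \o a \o iter i (inv s)) disj.
  move=> i; split.
    apply: aut_comp (aut_iter _ asi); apply: aut_comp (aut_iter _ as_) (aut_on_aut Aa).
  by move=> x nW /=; rewrite Aa.2 // iterK.
exists b; split=> //; have ab := aut_on_aut Ab.
suff H x : b (s x) = a (s (b x)).
  apply/funext => x; have := H (inv b (inv s x)).
  by rewrite /= invVK // invVK // => ->.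
case: (pselect (exists i, Wi i x)) => [[i Wx]|nW].
  have Wsx : Wi i.+1 (s x) by rewrite /Wi iterSr invK.
  have e y : iter i.+1 (inv s) (s y) = iter i (inv s) y by rewrite iterSr invK.
  rewrite (bE _ _ Wsx) (bE _ _ Wx) /comp e iterS [RHS]Aa.2 // => W0.
  apply: (@lt_disj 0%N i.+1 _ _ W0) => //.
  by rewrite /Wi e iterVK; exact: aut_on_stable Aa Wx.
rewrite [b x]Ab.2 //; case: (pselect (W (s x))) => Wsx; first by rewrite (bE 0%N).
rewrite [b _]Ab.2 ?Aa.2 // => -[[|i]]; first by [].
by rewrite /Wi iterSr invK // => Wi'; apply: nW; exists i.
Qed.

Lemma decreasing_between (a b : rat) : a < b -> exists e : nat -> rat,
  (forall k, a < e k < b) /\ forall k, e k.+1 < e k.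
Proof.
move=> ab; pose e k := iter k (fun x => (a + x) / 2) ((a + b) / 2).
have eS k : e k.+1 = (a + e k) / 2 by [].
have eb k : a < e k < b.
  elim: k => [|k /andP[h1 h2]]; first by rewrite /e /=; lra.
  by rewrite eS; lra.
exists e; split=> // k; have /andP[h _] := eb k.
by rewrite eS; lra.
Qed.

Lemma rooms_disjoint (E : nat -> rat) : (forall m, E m < E m.+1) ->
  forall m n x, itv (E m) (E m.+1) x -> itv (E n) (E n.+1) x -> m = n.
Proof.
move=> Ei; have EM : {homo E : m n / (m <= n)%N >-> m <= n}.
  by apply: homo_leq => [//|y x z|n]; [exact: le_trans|exact: ltW].
move=> m n x /andP[h1 h2] /andP[h3 h4]; case: (ltngtP m n) => // /EM h; exfalso; lra.
Qed.

Definition action (T : Type) (act : (rat -> rat) -> T -> T) : Prop :=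
  (forall w, act idfun w = w) /\
  forall f g w, aut f -> aut g -> act (f \o g) w = act f (act g w).

Definition insensitive (T : Type) (act : (rat -> rat) -> T -> T) w (X : set rat) : Prop :=
  forall a, aut_on X a -> act a w = w.

Section SmallIndex.
Variables (Omega : countType) (act : (rat -> rat) -> Omega -> Omega) (w : Omega).
Hypothesis actP : action act.

Local Notation insensitive := (insensitive act w).

Lemma act_inv g u : aut g -> act (inv g) (act g u) = u.
Proof. by move=> ag; rewrite -actP.2 ?compVK ?actP.1 //; exact: aut_inv. Qed.

Lemma act_fix_inv g u : aut g -> act g u = u -> act (inv g) u = u.
Proof. by move=> ag gu; rewrite -[in LHS]gu act_inv. Qed.

Lemma act_fix_comp g h u : aut g -> aut h -> act g u = u -> act h u = u ->
  act (g \o h) u = u.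
Proof. by move=> ag ah gu hu; rewrite actP.2 ?hu. Qed.

Lemma act_fix_conj h a : aut h -> aut a -> act h w = w ->
  act (h \o a \o inv h) w = w -> act a w = w.
Proof.
move=> ah aa hw; have ai := aut_inv ah; have aha := aut_comp ah aa.
rewrite (actP.2 (h \o a) (inv h)) // (act_fix_inv ah hw) (actP.2 h a) // => e.
by rewrite -[LHS](act_inv _ ah) e act_fix_inv.
Qed.

Lemma insensitive_sub (X Y : set rat) : (forall x, X x -> Y x) -> insensitive Y -> insensitive X.
Proof. by move=> XY gY a /(aut_on_sub XY) /gY. Qed.

(** Otherwise every [n] has an [a n] on [X n] that is induced by no [h] sending [w] to the point
    with code [n]. Gluing all [a n] gives a map that contradicts this for the code of its own value
    at [w]. *)
Lemma diagonal (X : nat -> set rat) : (forall i j x, X i x -> X j x -> i = j) ->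
  exists n, forall a, aut_on (X n) a -> exists h,
    [/\ aut_on (fun x => exists n, X n x) h, act h w = w & forall x, X n x -> h x = a x].
Proof.
move=> dX; set U : set rat := fun x => _.
have [n hn] : exists n, forall a, aut_on (X n) a -> exists h,
    [/\ aut_on U h, pickle (act h w) = n & forall x, X n x -> h x = a x].
  apply: contrapT => /forallNP H.
  have /choice [a aP] : forall n, exists a, aut_on (X n) a /\ forall h, aut_on U h ->
      pickle (act h w) = n -> (forall x, X n x -> h x = a x) -> False.
    move=> n; have /existsNP [a /not_implyP [Aa na]] := H n.
    by exists a; split=> // h Ah hn ha; apply: na; exists h.
  have [g [Ag gE]] := glue_aut dX (fun n => (aP n).1).
  exact: ((aP (pickle (act g w))).2 g Ag erefl (gE _)).
(* Two maps sending [w] to the same point differ by an element of the stabilizer; [g0] is the one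
   inducing the identity on [X n]. *)
exists n => a Aa; have [g0 [Ag0 g0n g0E]] := hn _ (aut_on_id (X n)).
have [g [Ag gn gE]] := hn _ Aa.
have ag := aut_on_aut Ag; have ag0 := aut_on_aut Ag0.
exists (inv g0 \o g); split.
- exact: aut_on_comp (aut_on_inv Ag0) Ag.
- rewrite actP.2 ?(pcan_inj pickleK (etrans gn (esym g0n))) ?act_inv //.
  exact: aut_inv.
- move=> x Xx /=; rewrite gE // -[a x in LHS](g0E) ?invK //.
  exact: aut_on_stable Aa Xx.
Qed.

(* The stabilizer meets the group of the first block in a normal subgroup, so
   that commutators of elements of a block inside that block lie in it. *)
Lemma diagonal_commutator (X : nat -> nat -> set rat) :
  (forall n j m k x, X n j x -> X m k x -> n = m /\ j = k) ->
  exists n j, forall a b, aut_on (X n j) a -> aut_on (X n j) b ->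
    act (a \o b \o inv a \o inv b) w = w.
Proof.
move=> dX; pose Y n : set rat := fun x => exists j, X n j x.
have [|n H1] := @diagonal Y.
  by move=> i j x [k Xk] [l Xl]; have [] := dX _ _ _ _ _ Xk Xl.
have [|j H2] := @diagonal (X n).
  by move=> i j x Xi Xj; have [] := dX _ _ _ _ _ Xi Xj.
exists n, j => a b Aa Ab; have AbY : aut_on (Y n) b by apply: aut_on_sub Ab => x; exists j.
(* On [X n j] the map [a] is replaced by [h] from the stabilizer. Since [h] is supported in [Y n],
   the remaining conjugation by [b] can be replaced by one by [k], also in the stabilizer. *)
have [h [Ah hw ha]] := H2 _ Aa; have [k [Ak kw kb]] := H1 _ AbY.
have [aa ab] := (aut_on_aut Aa, aut_on_aut Ab); have [ah ak] := (aut_on_aut Ah, aut_on_aut Ak).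
rewrite -(conj_local ah Aa ha Ab).
have -> : h \o b \o inv h \o inv b = h \o (b \o inv h \o inv b) by [].
rewrite -(conj_local ak AbY kb (aut_on_inv Ah)).
have aih := aut_inv ah; have aik := aut_inv ak.
have akh := aut_comp ak aih; have hvw := act_fix_inv ah hw.
have kvw := act_fix_inv ak kw; have khw := act_fix_comp ak aih kw hvw.
exact: (act_fix_comp ah (aut_comp akh aik) hw (act_fix_comp akh aik khw kvw)).
Qed.

(** Each interval is given infinitely many disjoint rooms, numbered by pairs. For one number [k],
    commutators of maps supported in the union of the [k]-th rooms fix [w]; by the swindle, every
    map supported in wandering subintervals of these rooms is such a commutator. *)
Lemma insensitive_subintervals (v u : nat -> rat) : (forall m, v m < u m) ->
  (forall m n x, itv (v m) (u m) x -> itv (v n) (u n) x -> m = n) ->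
  exists p q, (forall m, [/\ v m < p m, p m < q m & q m < u m]) /\
    insensitive (fun x => exists m, itv (p m) (q m) x).
Proof.
move=> vu dvu.
have /choice [e eP] := fun m => decreasing_between (vu m).
pose R m k := itv (e m k.+1) (e m k).
have eM m : {homo e m : i j / (i <= j)%N >-> j <= i}.
  by apply: homo_leq => [//|y x z|n]; [move=> h1 h2; exact: le_trans h2 h1|exact/ltW/(eP m).2].
have Rvu m k x : R m k x -> itv (v m) (u m) x.
  have /andP[h1 _] := (eP m).1 k.+1; have /andP[_ h2] := (eP m).1 k.
  by rewrite /R /itv => /andP[h3 h4]; apply/andP; split; lra.
have Rk m k l x : R m k x -> R m l x -> k = l.
  move=> /andP[h1 h2] /andP[h3 h4].
  by case: (ltngtP k l) => // /(eM m) h; exfalso; lra.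
have [|n [j cP]] := @diagonal_commutator (fun n j x => exists m, R m (pickle (n, j)) x).
  move=> n j n' j' x [m Rm] [m' Rm'].
  have mm := dvu _ _ _ (Rvu _ _ _ Rm) (Rvu _ _ _ Rm'); rewrite -mm in Rm'.
  by have /(pcan_inj pickleK) [-> ->] := Rk _ _ _ _ Rm Rm'.
set k := pickle (n, j) in cP.
(* Glued from maps taking [p m] to [q m] inside the room, [s] pushes the interval [(p m, q m)] off
   itself for good. *)
pose p m := (e m k.+1 + e m k) / 2; pose q m := (p m + e m k) / 2.
have ek m : e m k.+1 < e m k := (eP m).2 k.
have pq m : [/\ e m k.+1 < p m, p m < q m & q m < e m k].
  by have := ek m; rewrite /q /p; split; lra.
have /choice [t tP] : forall m, exists g, aut_on (R m k) g /\ g (p m) = q m.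
  by move=> m; have [h1 h2 h3] := pq m; apply: move_point; rewrite /itv; lra.
have [|s [As sE]] := @glue_aut (R^~ k) t _ (fun m => (tP m).1).
  by move=> m m' x /Rvu h1 /Rvu h2; exact: dvu h1 h2.
have as_ := aut_on_aut As.
have sp m : s (p m) = q m.
  by rewrite (sE m) ?(tP m).2 //; have [] := pq m; rewrite /R /itv; lra.
have sR m x : R m k x -> R m k (s x).
  by move=> Rx; rewrite (sE m) //; exact: aut_on_stable (tP m).1 Rx.
pose W : set rat := fun x => exists m, itv (p m) (q m) x.
have WR m x : itv (p m) (q m) x -> R m k x.
  by have [] := pq m; rewrite /R /itv; lra.
exists p, q; split.
  move=> m; have [h1 h2 h3] := pq m; have /andP[h4 _] := (eP m).1 k.+1.
  by have /andP[_ h5] := (eP m).1 k; split; lra.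
move=> a Aa; have [|b [Ab ->]] := swindle as_ _ Aa.
  move=> i x [m xm]; suff [h1 h2] : q m < iter i.+1 s x /\ R m k (iter i.+1 s x).
    move=> [m' /[dup] /WR xm' /andP[_ h3]].
    by have mm := dvu _ _ _ (Rvu _ _ _ h2) (Rvu _ _ _ xm'); subst m'; lra.
  have [_ pqm _] := pq m.
  elim: i => [|i [h1 h2]]; last first.
    rewrite iterS; split; last exact: sR.
    by apply: lt_trans (_ : s (q m) < _); rewrite ?aut_lt // -{1}sp aut_lt.
  by split; [rewrite /= -sp aut_lt //; case/andP: xm|exact/sR/WR].
apply: cP => //; apply: aut_on_sub Ab => x [i [m /WR xm]]; exists m.
have RE : R m k (iter i s (iter i (inv s) x)).
  by elim: i {xm} (iter i (inv s) x) xm => //= i IH y /IH /sR.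
suff iterK y : iter i s (iter i (inv s) y) = y by rewrite -[x]iterK.
by elim: i y {xm RE} => [|i IH] y //; rewrite iterS iterSr IH invVK.
Qed.

End SmallIndex.

(** * Automorphisms supported near a cut *)

Section Germs.
Variables (Omega : countType) (act : (rat -> rat) -> Omega -> Omega) (w : Omega).
Hypothesis actP : action act.

Local Notation insensitive := (insensitive act w).

(* Let [al f] act as the power [f m] of a contraction of the room [itv (r m) (s m)].
   aut_on function [F] dominating one representative of each value of [act (al f) w]
   yields [f] with [f m < F m] for large [m] and [act (al f) w = act (al F) w], so
   the stabilizer contains an element contracting almost all of the intervals. *)
Lemma insensitive_tail (r v u s : nat -> rat) :
  (forall m, [/\ r m < v m, v m < u m & u m < s m]) ->
  (forall m n x, itv (r m) (s m) x -> itv (r n) (s n) x -> m = n) ->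
  exists N, insensitive (fun x => exists m, (N <= m)%N /\ itv (v m) (u m) x).
Proof.
move=> rvus drs.
have vr m x : itv (v m) (u m) x -> itv (r m) (s m) x.
  by have [] := rvus m; rewrite /itv; lra.
have [||p [q [pq gpq]]] := @insensitive_subintervals _ _ w actP v u.
- by move=> m; have [] := rvus m.
- by move=> m n x /vr h1 /vr h2; exact: drs h1 h2.
have /choice [b bP] : forall m, exists g,
    [/\ aut_on (itv (r m) (s m)) g, g (v m) = p m & g (u m) = q m].
  move=> m; have [h1 h2 h3] := rvus m; have [h4 h5 h6] := pq m.
  by apply: move_two_points => //; lra.
have Ab m : aut_on (itv (r m) (s m)) (b m) by have [] := bP m.
have /choice [al alP] : forall f : nat -> nat, exists g,
    aut_on (fun x => exists m, itv (r m) (s m) x) g /\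
    forall m x, itv (r m) (s m) x -> g x = iter (f m) (b m) x.
  by move=> f; apply: glue_aut => // m; exact: aut_on_iter.
have aal f := aut_on_aut (alP f).1.
pose color f : nat := pickle (act (al f) w).
(* Since [Omega] is countable, one representative [rep n] for each color [n] that occurs makes a
   countable family, which a single function can dominate. *)
have /choice [rep repP] : forall n, exists f, (exists f', color f' = n) -> color f = n.
  move=> n; have [[f fn]|nf] := pselect (exists f', color f' = n); first by exists f.
  by exists (fun=> 0%N).
(* For [n <= m] the sum contains [rep n m], and the successor makes the inequality strict. *)
pose F m := (\sum_(n < m.+1) rep n m).+1.
pose f := rep (color F).
have fF m : (color F <= m)%N -> (f m < F m)%N.
  rewrite -ltnS => cm; rewrite ltnS /F (bigD1 (Ordinal cm)) //=; exact: leq_addr.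
have cf : color f = color F by apply: repP; exists F.
(* In the room [m] this is a positive power of [b m] once [m] is at least [color F], so it maps
   [(v m, u m)] into [(p m, q m)]. Conjugation by [h] then moves the support into the intervals
   where [w] is known to be fixed. *)
pose h := inv (al f) \o al F.
have aif := aut_inv (aal f); have ah : aut h by exact: aut_comp.
have hw : act h w = w.
  by rewrite actP.2 // -(pcan_inj pickleK cf) (act_inv actP).
have hE m x : (color F <= m)%N -> itv (r m) (s m) x -> h x = iter (F m - f m) (b m) x.
  move=> cm xm; rewrite /h /= ((alP F).2 m) // -{1}(subnKC (ltnW (fF _ cm))) iterD.
  by rewrite -((alP f).2 m) ?invK //; exact: aut_on_stable (aut_on_iter _ (Ab m)) xm.
have bpq m x : itv (v m) (u m) x -> itv (p m) (q m) (b m x).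
  by have [[ab _] <- <-] := bP m; rewrite /itv !aut_lt.
have pv m x : itv (p m) (q m) x -> itv (v m) (u m) x.
  by have [] := pq m; rewrite /itv; lra.
have hpq m x : (color F <= m)%N -> itv (v m) (u m) x -> itv (p m) (q m) (h x).
  move=> cm xm; rewrite (hE m) //; last exact: vr.
  have : (0 < F m - f m)%N by rewrite subn_gt0 fF.
  case: (_ - _)%N => // k _; elim: k => [|k IH]; first exact: bpq.
  by rewrite iterS; apply/bpq/pv.
exists (color F) => a Aa; apply: (act_fix_conj actP ah (aut_on_aut Aa) hw).
have aih := aut_inv ah.
apply: gpq; split; first by do 2?apply: aut_comp => //; exact: aut_on_aut Aa.
move=> x nx /=; rewrite Aa.2 ?invVK // => -[m [cm xm]].
by apply: nx; exists m; rewrite -[x](invVK ah); exact: hpq.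
Qed.

Section LowerSet.
Variable L : set rat.
Hypotheses (lowL : forall x y, L y -> x <= y -> L x) (neL : exists x, L x)
  (openL : forall x, L x -> exists y, L y /\ x < y).

(** Otherwise one finds, further and further to the right in [L], separated intervals none of which
    is insensitive, against [insensitive_tail]. *)
Lemma insensitive_bounded : exists c, L c /\ forall d, L d -> insensitive (itv c d).
Proof.
apply: contrapT => /forallNP H.
have /choice [nxt nxtP] : forall e, exists t : rat * rat * rat, L e ->
    [/\ e < t.1.1, t.1.1 < t.1.2, t.1.2 < t.2, L t.2 & ~ insensitive (itv t.1.1 t.1.2)].
  move=> e; have [Le|] := pselect (L e); last by exists (0, 0, 0).
  have [c [Lc ec]] := openL Le.
  have /not_andP [//|/existsNP [d /not_implyP [Ld nd]]] := H c.
  have [f [Lf df]] := openL Ld; exists (c, d, f) => _; split=> //=.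
  rewrite ltNge; apply/negP => dc; apply: nd => a Aa.
  suff -> : a = idfun by exact: actP.1.
  by apply/funext => x; apply: Aa.2; rewrite /itv; lra.
have [e0 Le0] := neL.
pose E := fix E n := if n is m.+1 then (nxt (E m)).2 else e0.
have LE n : L (E n) by elim: n => //= n /nxtP [].
have [||N] := @insensitive_tail E (fun m => (nxt (E m)).1.1) (fun m => (nxt (E m)).1.2)
    (fun m => E m.+1).
- by move=> m; have [h1 h2 h3 _ _] := nxtP _ (LE m).
- apply: rooms_disjoint => m; have [h1 h2 h3 _ _] := nxtP _ (LE m).
  by rewrite /=; lra.
have [_ _ _ _ nN] := nxtP _ (LE N).
by move=> gN; apply: nN; apply: insensitive_sub gN => x xN; exists N.
Qed.

(** Almost all of the intervals are covered by [insensitive_tail], with the gaps between them as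
    spare room; the finitely many others lie in one bounded interval [(c, E N.*2)]. *)
Lemma insensitive_alternate c (E : nat -> rat) : (forall d, L d -> insensitive (itv c d)) ->
  (forall n, L (E n)) -> (forall n, E n < E n.+1) -> c <= E 0%N ->
  insensitive (fun x => exists m, itv (E m.*2) (E m.*2.+1) x).
Proof.
move=> gc LE Ei cE a Aa; have aa := aut_on_aut Aa.
have EM : {homo E : m n / (m <= n)%N >-> m <= n}.
  by apply: homo_leq => [//|y x z|n]; [exact: le_trans|exact: ltW].
(* The rooms are bounded by midpoints of the gaps; to the left of [E 0] any smaller number will
   do. *)
pose r m := if m is m'.+1 then (E m'.*2.+1 + E m.*2) / 2 else E 0%N - 1.
have rP m : r m < E m.*2 /\ E m.*2.+1 < r m.+1.
  split; last by have := Ei m.*2.+1; rewrite /r doubleS; lra.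
  by case: m => [|m]; rewrite /r; [lra|have := Ei m.*2.+1; rewrite doubleS; lra].
have [||N gN] := @insensitive_tail r (fun m => E m.*2) (fun m => E m.*2.+1) (fun m => r m.+1).
- by move=> m; have [h1 h2] := rP m; split=> //.
- apply: rooms_disjoint => m; have [h1 h2] := rP m; have := Ei m.*2; lra.
have fixE n : a (E n) = E n.
  apply: Aa.2 => -[m /andP[h1 h2]].
  have [h|h] := leqP n m.*2; first by have := EM _ _ h; lra.
  by have := EM _ _ h; lra.
have ac : a c = c.
  apply: Aa.2 => -[m /andP[h1 h2]].
  by have := EM 0%N m.*2 isT; lra.
have [|a1 [a2 [Aa1 Aa2 aE _ a2E]]] := @aut_split a (itv c (E N.*2)) aa.
  move=> x xab; exists (itv c (E N.*2)); split=> // [y1 v z|y]; rewrite /itv; first lra.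
  by rewrite -[in X in _ <-> X]ac -[in X in _ <-> X](fixE N.*2) !aut_lt.
rewrite aE; apply: (act_fix_comp actP); [exact: aut_on_aut Aa1|exact: aut_on_aut Aa2|exact: gc Aa1|].
apply: gN; split; first exact: aut_on_aut Aa2.
move=> x nx; have [xc|nxc] := pselect (itv c (E N.*2) x); first exact: Aa2.2.
rewrite a2E // Aa.2 // => -[m xm]; have [Nm|mN] := leqP N m.
  by apply: nx; exists m.
apply: nxc; move: xm; rewrite /itv => /andP[h1 h2]; apply/andP; split.
  by have := EM 0%N m.*2 isT; lra.
have : (m.*2.+1 <= N.*2)%N by lia.
by move=> /EM; lra.
Qed.

(** A map fixing all [E n] is the product of its parts on the even intervals, on the odd intervals
    and on [(c, E 0)]; cofinality of [E] excludes any further part. *)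
Lemma insensitive_fix c (E : nat -> rat) : (forall d, L d -> insensitive (itv c d)) ->
  (forall n, L (E n)) -> (forall n, E n < E n.+1) -> c <= E 0%N ->
  (forall x, L x -> exists n, x < E n) ->
  forall a, aut_on (fun x => L x /\ c < x) a -> (forall n, a (E n) = E n) -> act a w = w.
Proof.
move=> gc LE Ei cE cof a Aa aE; have aa := aut_on_aut Aa.
have EM : {homo E : m n / (m <= n)%N >-> m <= n}.
  by apply: homo_leq => [//|y x z|n]; [exact: le_trans|exact: ltW].
have splitE (k : rat -> rat) i : aut k -> (forall n, k (E n) = E n) -> exists k1 k2,
    [/\ aut_on (fun x => exists m, itv (E (m.*2 + i)%N) (E (m.*2 + i).+1) x) k1,
     aut_on (fun x => ~ exists m, itv (E (m.*2 + i)%N) (E (m.*2 + i).+1) x) k2,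
     k = k1 \o k2 &
     forall x, ~ (exists m, itv (E (m.*2 + i)%N) (E (m.*2 + i).+1) x) -> k2 x = k x].
  move=> ak kE.
  have [|k1 [k2 [h1 h2 h3 _ h4]]] := @aut_split k
      (fun x => exists m, itv (E (m.*2 + i)%N) (E (m.*2 + i).+1) x) ak; last by exists k1, k2.
  move=> x [m xm]; exists (itv (E (m.*2 + i)%N) (E (m.*2 + i).+1)).
  split=> // [y ym|y1 v z|y]; [by exists m|rewrite /itv; lra|].
  by rewrite /itv -[in X in _ <-> X](kE (m.*2 + i)%N) -[in X in _ <-> X](kE (m.*2 + i).+1) !aut_lt.
have [k1 [a' [Ak1 Aa' e1 a'E]]] := splitE _ 0%N aa aE.
have aa' := aut_on_aut Aa'.
have a'fix n : a' (E n) = E n.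
  rewrite a'E ?aE // => -[m /andP[h1 h2]].
  have [h|h] := leqP n (m.*2 + 0); first by have := EM _ _ h; lra.
  by have := EM _ _ h; lra.
have [k2 [a2 [Ak2 Aa2 e2 a2E]]] := splitE _ 1%N aa' a'fix.
have [ak1 ak2] := (aut_on_aut Ak1, aut_on_aut Ak2); have aa2 := aut_on_aut Aa2.
rewrite e1 e2; apply: (act_fix_comp actP) => //; first exact: aut_comp.
  apply: (insensitive_alternate gc LE Ei cE); apply: aut_on_sub Ak1 => x [m xm]; exists m.
  by move: xm; rewrite addn0.
apply: (act_fix_comp actP) => //.
  apply: (@insensitive_alternate c (fun n => E n.+1)) => //; first exact: ltW (le_lt_trans cE _).
  by apply: aut_on_sub Ak2 => x [m xm]; exists m; move: xm; rewrite addn1.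
apply: (gc _ (LE 0%N)); split=> // x nx.
have a2fix n : a2 (E n) = E n.
  rewrite a2E ?a'fix // => -[m /andP[h1 h2]].
  have [h|h] := leqP n (m.*2 + 1); first by have := EM _ _ h; lra.
  by have := EM _ _ h; lra.
have [[n xn]|nE] := pselect (exists n, x = E n); first by rewrite xn.
have [[m xm]|n1] := pselect (exists m, itv (E (m.*2 + 1)%N) (E (m.*2 + 1).+1) x).
  by apply: Aa2.2 => /(_ (ex_intro _ m xm)).
rewrite a2E //.
have [[m xm]|n0] := pselect (exists m, itv (E (m.*2 + 0)%N) (E (m.*2 + 0).+1) x).
  by apply: Aa'.2 => /(_ (ex_intro _ m xm)).
rewrite a'E //; apply: Aa.2 => -[Lx cx].
have xE : E 0%N < x.
  rewrite ltNge le_eqVlt; apply/negP => /orP[/eqP xe|xe].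
    by apply: nE; exists 0%N.
  by apply: nx; rewrite /itv cx.
have [n xn] := cof _ Lx.
elim: n xn => [|n IH] xn; first by lra.
have [xn'|] := ltP x (E n); first exact: IH.
rewrite le_eqVlt => /orP[/eqP xe|xe]; first by apply: nE; exists n.
have nE2 : n = (n./2.*2 + odd n)%N by rewrite addnC odd_double_half.
case: (odd n) nE2 => e; [apply: n1|apply: n0]; exists n./2; rewrite -e /itv xe xn.
  by [].
by [].
Qed.

(** For [g] supported in [L] above [c], choose [E] so sparse that [g] and its inverse send [E n]
    below [E n.+1]. Then some [p] fixes the even points [E n] and agrees with [g] at the odd ones,
    so [g] is the product of [p] and of [inv p \o g], which fixes the odd points; [insensitive_fix]
    applies to both. *)
Lemma insensitive_left_germ : exists c, L c /\ insensitive (fun x => L x /\ c < x).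
Proof.
have [c [Lc gc]] := insensitive_bounded.
exists c; split=> // g Ag; have ag := aut_on_aut Ag; have aig := aut_inv ag.
have Lstep k x : aut_on (fun x => L x /\ c < x) k -> L x -> L (k x).
  move=> Ak Lx; have [cx|xc] := ltP c x; first by have [] := aut_on_stable Ak (conj Lx cx).
  by rewrite Ak.2 // => -[_]; lra.
(* The last condition, running through an enumeration of the rationals, makes the sequence cofinal
   in [L]. *)
have /choice [nxt nxtP] : forall nx : nat * rat, exists y, L nx.2 ->
    [/\ L y, nx.2 < y, g nx.2 < y, inv g nx.2 < y &
        L (enum_rat nx.1) -> enum_rat nx.1 < y].
  move=> [n x]; have [Lx|] := pselect (L x); last by exists 0.
  pose z := if pselect (L (enum_rat n)) then enum_rat n else x.
  have Lz : L z by rewrite /z; case: pselect.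
  have zE : L (enum_rat n) -> z = enum_rat n by rewrite /z; case: pselect.
  have Lm y1 y2 : L y1 -> L y2 -> L (Num.max y1 y2).
    by move=> h1 h2; rewrite /Num.max; case: ifP.
  have [y [Ly]] := openL (Lm _ _ (Lm _ _ Lx Lz)
    (Lm _ _ (Lstep _ _ Ag Lx) (Lstep _ _ (aut_on_inv Ag) Lx))).
  rewrite !gt_max => /andP[/andP[h1 h2] /andP[h3 h4]].
  by exists y => _; split=> // /zE <-.
have [e0 [Le0 ce0]] := openL Lc.
pose E := fix E n := if n is m.+1 then nxt (m, E m) else e0.
have LE n : L (E n) by elim: n => //= n IH; have [] := nxtP (n, E n) IH.
have Ei n : E n < E n.+1 by have [] := nxtP (n, E n) (LE n).
have gE n : g (E n) < E n.+1 by have [] := nxtP (n, E n) (LE n).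
have igE n : E n < g (E n.+1).
  by rewrite -[E n](invVK ag) aut_lt //; have [] := nxtP (n, E n) (LE n).
have cof x : L x -> exists n, x < E n.
  have [n <-] := enum_ratP x => Lx; exists n.+1.
  by have [_ _ _ _] := nxtP (n, E n) (LE n); apply.
have EM : {homo E : m n / (m <= n)%N >-> m <= n}.
  by apply: homo_leq => [//|y x z|n]; [exact: le_trans|exact: ltW].
have /choice [b bP] : forall m, exists k,
    aut_on (itv (E m.*2) (E m.+1.*2)) k /\ k (E m.*2.+1) = g (E m.*2.+1).
  by move=> m; apply: move_point; rewrite /itv doubleS ?Ei ?gE ?igE.
have [|p [Ap pE]] := glue_aut _ (fun m => (bP m).1).
  by apply: (@rooms_disjoint (fun m => E m.*2)) => m; rewrite doubleS; exact: lt_trans (Ei _).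
have ap := aut_on_aut Ap.
have ApL : aut_on (fun x => L x /\ c < x) p.
  apply: aut_on_sub Ap => x [m /andP[h1 h2]]; split; first exact: lowL (LE _) (ltW h2).
  by have := EM 0%N m.*2 isT; rewrite /=; lra.
have p0 m : p (E m.*2) = E m.*2.
  apply: Ap.2 => -[n /andP[h1 h2]].
  have [h|h] := leqP m n; first by have := EM m.*2 n.*2 ltac:(lia); lra.
  by have := EM n.+1.*2 m.*2 ltac:(lia); lra.
have p1 m : p (E m.*2.+1) = g (E m.*2.+1).
  by rewrite (pE m) ?(bP m).2 // /itv doubleS !Ei.
have -> : g = p \o (inv p \o g) by apply/funext => x /=; rewrite invVK.
have Aq : aut_on (fun x => L x /\ c < x) (inv p \o g) by exact: aut_on_comp (aut_on_inv ApL) Ag.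
apply: (act_fix_comp actP) => //; first exact: aut_on_aut Aq.
  apply: (@insensitive_fix c (fun n => E n.*2)) => // [n||x Lx].
  - by rewrite doubleS; exact: lt_trans (Ei _).
  - by rewrite /=; lra.
  - have [n xn] := cof _ Lx; exists n; apply: lt_le_trans xn _; apply: EM; lia.
apply: (@insensitive_fix c (fun n => E n.*2.+1)) => // [n||x Lx|n].
- by rewrite doubleS; exact: lt_trans (Ei _).
- by have := Ei 0%N; rewrite /=; lra.
- have [n xn] := cof _ Lx; exists n; apply: lt_le_trans xn _; apply: EM; lia.
- by rewrite /= -p1 invK.
Qed.

End LowerSet.
End Germs.

(** * Finite supports and essential points *)

Definition open_convex (C : set rat) : Prop :=
  convex C /\ forall x, C x -> exists a b, [/\ C a, C b & a < x < b].

Definition support (T : Type) (act : (rat -> rat) -> T -> T) w (F : seq rat) : Prop :=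
  forall g, aut g -> (forall x, x \in F -> g x = x) -> act g w = w.

Definition essential (T : Type) (act : (rat -> rat) -> T -> T) w (x : rat) : Prop :=
  forall a b, itv a b x -> ~ insensitive act w (itv a b).

Lemma aut_split_lt k u : aut k -> k u = u -> exists k1 k2,
  [/\ aut_on (fun x => x < u) k1, aut_on (fun x => ~ x < u) k2, k = k1 \o k2,
    forall x, x < u -> k1 x = k x & forall x, ~ x < u -> k2 x = k x].
Proof.
move=> ak ku; apply: (aut_split ak) => x xu; exists (fun x => x < u).
split=> // [x1 y z _ zu /andP[_ yz]|y]; first exact: le_lt_trans zu.
by rewrite -[in X in _ <-> X]ku aut_lt.
Qed.

Section Support.
Variables (Omega : countType) (act : (rat -> rat) -> Omega -> Omega).
Hypothesis actP : action act.

Section Point.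
Variable w : Omega.
Local Notation insensitive := (insensitive act w).

(** A map [s] supported in [I] or in [J] brings [g u] back to [u]. Then [s \o g] fixes [u] and
    splits there into a part supported in [I] and a part supported in [J]. *)
Lemma insensitive_merge (I J : set rat) u : open_convex I -> open_convex J -> I u -> J u ->
  (forall x, J x -> x < u -> I x) -> (forall x, I x -> u < x -> J x) ->
  insensitive I -> insensitive J -> insensitive (fun x => I x \/ J x).
Proof.
move=> cI cJ Iu Ju JI IJ gI gJ g Ag; have ag := aut_on_aut Ag.
have mv (C : set rat) x y : open_convex C -> C x -> C y -> exists k, aut_on C k /\ k x = y.
  move=> [cC oC] Cx Cy.
  have [a [b [Ca Cb /andP[ax xb]]]] := oC _ Cx.
  have [a' [b' [Ca' Cb' /andP[ay yb]]]] := oC _ Cy.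
  have [||k [Ak kx]] := @move_point (Num.min a a') (Num.max b b') x y.
  - by rewrite /itv gt_min lt_max ax xb.
  - by rewrite /itv gt_min lt_max ay yb !orbT.
  exists k; split=> //; apply: aut_on_sub Ak => z /andP[h1 h2].
  apply: (cC (Num.min a a') z (Num.max b b')); last by rewrite (ltW h1) (ltW h2).
    by rewrite /Num.min; case: ifP.
  by rewrite /Num.max; case: ifP.
have [s [As sw sg]] : exists s, [/\ aut_on (fun x => I x \/ J x) s, act s w = w & s (g u) = u].
  have [Igu|Jgu] : I (g u) \/ J (g u) by apply: (aut_on_stable Ag); left.
    have [s [As su]] := mv _ _ _ cI Igu Iu; exists s; split=> //; last exact: gI.
    by apply: aut_on_sub As => x; left.
  have [s [As su]] := mv _ _ _ cJ Jgu Ju; exists s; split=> //; last exact: gJ.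
  by apply: aut_on_sub As => x; right.
have as_ := aut_on_aut As; have Asg := aut_on_comp As Ag.
have [k1 [k2 [Ak1 Ak2 e k1E k2E]]] := aut_split_lt (aut_on_aut Asg) sg.
have asg : act (s \o g) w = w.
  rewrite e; apply: (act_fix_comp actP (aut_on_aut Ak1) (aut_on_aut Ak2)).
    apply: gI; split=> [|x nI]; first exact: aut_on_aut Ak1.
    have [xu|nxu] := pselect (x < u); last exact: Ak1.2.
    by rewrite k1E // Asg.2 // => -[//|/JI /(_ xu)].
  apply: gJ; split=> [|x nJ]; first exact: aut_on_aut Ak2.
  have [xu|nxu] := pselect (x < u); first by apply: Ak2.2 => /(_ xu).
  rewrite k2E // Asg.2 // => -[Ix|//]; move/negP: nxu; rewrite -leNgt le_eqVlt.
  by move=> /orP[/eqP ux|/(IJ _ Ix)//]; apply: nJ; rewrite -ux.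
rewrite -[RHS](act_fix_inv actP as_ sw) -[in RHS]asg (actP.2 s g) // act_inv //.
Qed.

Lemma insensitive_right_germ (U : set rat) : (forall x y, U x -> x <= y -> U y) ->
  (exists x, U x) -> (forall x, U x -> exists y, U y /\ y < x) ->
  exists d, U d /\ insensitive (fun x => U x /\ x < d).
Proof.
move=> upU [x0 Ux0] opU.
(* Conjugation by the reflection of the line turns right germs into left germs. *)
pose neg (g : rat -> rat) x := - g (- x).
have autN g : aut g -> aut (neg g).
  move=> ag; split=> [x y xy|]; first by rewrite /neg ltrN2 aut_lt // ltrN2.
  by exists (neg (inv g)); split=> x; rewrite /neg opprK ?invK ?invVK // opprK.
have negK g : neg (neg g) = g by apply/funext => x; rewrite /neg !opprK.
have act'P : action (fun g => act (neg g)).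
  split=> [u|f g u af ag].
    rewrite (_ : neg idfun = idfun) ?actP.1 //.
    by apply/funext => x; rewrite /neg /= opprK.
  rewrite (_ : neg (f \o g) = neg f \o neg g); last first.
    by apply/funext => x; rewrite /neg /= opprK.
  by apply: actP.2; exact: autN.
have [|||c [Uc gc]] := @insensitive_left_germ Omega _ w act'P (fun x => U (- x)).
- by move=> x y Uy xy; apply: upU Uy _; rewrite lerN2.
- by exists (- x0); rewrite opprK.
- move=> x /opU [y [Uy yx]]; exists (- y); rewrite opprK; split=> //; lra.
exists (- c); split=> // a Aa; rewrite -[a]negK; apply: gc; split.
  exact/autN/aut_on_aut/Aa.
by move=> x nx; rewrite /neg Aa.2 ?opprK // => -[Ux xc]; apply: nx; split=> //; lra.
Qed.

(** Both one-sided germs at the cut are insensitive. If a stabilizing [h] moves some [y] from above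
    the cut to below it, then the preimage under [h] of the left germ is insensitive too and
    overlaps the right germ at [y], so that the two merge across the cut. Such an [h] exists because
    the automorphisms of [(c, d)] move the cut in more ways than the countable set [Omega] can tell
    apart. *)
Lemma insensitive_cut (L : set rat) : (forall x y, L y -> x <= y -> L x) ->
  (exists x, L x) -> (forall x, L x -> exists y, L y /\ x < y) ->
  (exists x, ~ L x) -> (forall x, ~ L x -> exists y, ~ L y /\ y < x) ->
  exists c d, [/\ L c, ~ L d & insensitive (itv c d)].
Proof.
move=> lowL neL opL neU opU.
have LU x y : L x -> ~ L y -> x < y.
  by move=> Lx Uy; rewrite ltNge; apply/negP => yx; apply: Uy; exact: lowL Lx yx.
have [c [Lc gc]] := insensitive_left_germ w actP lowL neL opL.
have [|d [Ud gd]] := @insensitive_right_germ (fun x => ~ L x) _ neU opU.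
  by move=> x y nLx xy Ly; apply: nLx; exact: lowL Ly xy.
exists c, d; split=> //; have cd := LU _ _ Lc Ud.
suff [h [y [Ah hw Uy Lhy]]] : exists h y,
    [/\ aut_on (itv c d) h, act h w = w, ~ L y & L (h y)].
  have ah := aut_on_aut Ah.
  have hc : h c = c by apply: Ah.2; rewrite /itv ltxx.
  have hd : h d = d by apply: Ah.2; rewrite /itv ltxx andbF.
  have yd : y < d by rewrite -(aut_lt _ _ ah) hd; exact: LU Lhy Ud.
  have cy := LU _ _ Lc Uy.
  have gI : insensitive (fun x => L (h x) /\ c < x).
    move=> a Aa; have [aa aih] := (aut_on_aut Aa, aut_inv ah).
    apply: (act_fix_conj actP ah aa hw); apply: gc; split.
      by apply: aut_comp aih; exact: aut_comp.
    move=> x nx /=; rewrite Aa.2 ?invVK // => -[Lx cx]; apply: nx.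
    by split=> //; rewrite -[x](invVK ah) -hc aut_lt.
  have oI : open_convex (fun x => L (h x) /\ c < x).
    split=> [x1 x2 x3 [_ cx1] [Lx3 _] /andP[x12 x23]|x [Lhx cx]].
      by split; [apply: lowL Lx3 _; rewrite aut_le|exact: lt_le_trans x12].
    have [z [Lz xz]] := opL _ Lhx; have cmid : c < (c + x) / 2 < x by lra.
    exists ((c + x) / 2), (inv h z); split.
    - split; last by case/andP: cmid.
      by apply: lowL Lhx _; rewrite aut_le //; lra.
    - rewrite invVK //; split=> //.
      by rewrite -(aut_lt _ _ ah) invVK // (lt_trans _ xz) // aut_lt.
    - rewrite -[x < inv h z](aut_lt _ _ ah) invVK // xz; lra.
  have oJ : open_convex (fun x => ~ L x /\ x < d).
    split=> [x1 x2 x3 [Ux1 _] [_ x3d] /andP[x12 x23]|x [Ux xd]].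
      by split; [move=> Lx2; apply: Ux1; exact: lowL Lx2 x12|exact: le_lt_trans x3d].
    have [z [Uz zx]] := opU _ Ux; exists z, ((x + d) / 2); split.
    - by split=> //; exact: lt_trans xd.
    - split; last lra.
      by move=> Lm; apply: Ux; apply: lowL Lm _; lra.
    - by rewrite zx; lra.
  have := insensitive_merge (u := y) oI oJ (conj Lhy cy) (conj Uy yd) _ _ gI gd.
  have p1 x : ~ L x /\ x < d -> x < y -> L (h x) /\ c < x.
    move=> [Ux _] xy; split; last exact: LU Lc Ux.
    by apply: lowL Lhy _; rewrite aut_le // ltW.
  have p2 x : L (h x) /\ c < x -> y < x -> ~ L x /\ x < d.
    move=> [Lhx _] yx; split; last by rewrite -(aut_lt _ _ ah) hd; exact: LU Lhx Ud.
    by move=> Lx; apply: Uy; apply: lowL Lx (ltW yx).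
  move=> /(_ p1 p2); apply: insensitive_sub => x /andP[cx xd].
  have [Lx|Ux] := pselect (L x); [left|by right].
  by split=> //; apply: lowL Lhy _; rewrite aut_le // ltW // LU.
have /choice [rep repP] : forall n, exists g, aut_on (itv c d) g /\
    forall g', aut_on (itv c d) g' -> pickle (act g' w) = n -> pickle (act g w) = n.
  move=> n; have [[g [Ag gn]]|nex] :=
    pselect (exists g, aut_on (itv c d) g /\ pickle (act g w) = n); first by exists g.
  exists idfun; split=> [|g' Ag' g'n]; first exact: aut_on_id.
  by case: nex; exists g'.
(* A map meeting [E n] sends two points from different sides of the cut to the same side of the cut
   moved by [rep n]; it thus differs from [rep n] in its effect on the cut. *)
pose E n (s : seq (rat * rat)) := exists p q, [/\ p \in s, q \in s, c < p.1 /\ L p.1,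
  ~ L q.1 /\ q.1 < d & L (inv (rep n) p.2) <-> L (inv (rep n) q.2)].
have [||f [f' [ff' f'f fi fs fE]]] := @back_and_forth _ _ _ _ enum_rat enum_rat
    [:: (c, c); (d, d)] E rat_saturated rat_saturated enum_ratP enum_ratP.
- by move=> p q; rewrite !inE => /orP[]/eqP-> /orP[]/eqP->.
- move=> n s os s0s.
  have cs : (c, c) \in s by apply: s0s; rewrite !inE eqxx.
  have ds : (d, d) \in s by apply: s0s; rewrite !inE eqxx orbT.
  have LUs p q : p \in s -> q \in s -> L p.1 -> ~ L q.1 -> p.2 < q.2.
    by move=> ps qs Lp Uq; rewrite -(os _ _ ps qs); exact: LU.
  have [x [Lx xs]] : exists x, L x /\ forall p, p \in s -> L p.1 -> p.1 < x.
    elim: (s) => [|p s' [x [Lx xs]]]; first by exists c.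
    have [Lp|nLp] := pselect (L p.1); last first.
      by exists x; split=> // q; rewrite inE => /orP[/eqP->//|]; exact: xs.
    have [z [Lz pz]] := opL _ Lp; exists (Num.max x z); split.
      by rewrite /Num.max; case: ifP.
    move=> q; rewrite inE lt_max => /orP[/eqP->|/xs h]; first by rewrite pz orbT.
    by move=> /h ->.
  have [y [Uy ys]] : exists y, ~ L y /\ forall p, p \in s -> ~ L p.1 -> y < p.1.
    elim: (s) => [|p s' [y [Uy ys]]]; first by exists d.
    have [Lp|nLp] := pselect (L p.1).
      by exists y; split=> // q; rewrite inE => /orP[/eqP->//|]; exact: ys.
    have [z [Lz pz]] := opU _ nLp; exists (Num.min y z); split.
      by rewrite /Num.min; case: ifP.
    move=> q; rewrite inE gt_min => /orP[/eqP->|/ys h]; first by rewrite pz orbT.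
    by move=> /h ->.
  pose below := [seq p.2 | p <- s & `[< L p.1 >]].
  pose above := [seq p.2 | p <- s & ~~ `[< L p.1 >]].
  have between l u : (forall b, b \in below -> b < l) -> (forall b, b \in above -> u < b) ->
      l < u -> order_preserving [:: (x, l), (y, u) & s].
    move=> hl hu lu.
    have xl p : p \in s -> (x < p.1) = (l < p.2) /\ (p.1 < x) = (p.2 < l).
      move=> ps; have [Lp|Up] := pselect (L p.1).
        have h1 := xs _ ps Lp; have h2 : p.2 < l.
          by apply: hl; apply/mapP; exists p => //; rewrite mem_filter ps andbT; exact/asboolP.
        by rewrite h1 h2 (lt_gtF h1) (lt_gtF h2).
      have h1 := LU _ _ Lx Up; have h2 : l < p.2.
        apply: lt_trans lu _; apply: hu; apply/mapP; exists p => //.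
        by rewrite mem_filter ps andbT; exact/asboolPn.
      by rewrite h1 h2 (lt_gtF h1) (lt_gtF h2).
    have yu p : p \in s -> (y < p.1) = (u < p.2) /\ (p.1 < y) = (p.2 < u).
      move=> ps; have [Lp|Up] := pselect (L p.1).
        have h1 := LU _ _ Lp Uy; have h2 : p.2 < u.
          apply: lt_trans lu; apply: hl; apply/mapP; exists p => //.
          by rewrite mem_filter ps andbT; exact/asboolP.
        by rewrite h1 h2 (lt_gtF h1) (lt_gtF h2).
      have h1 := ys _ ps Up; have h2 : u < p.2.
        by apply: hu; apply/mapP; exists p => //; rewrite mem_filter ps andbT; exact/asboolPn.
      by rewrite h1 h2 (lt_gtF h1) (lt_gtF h2).
    have xy := LU _ _ Lx Uy.
    move=> p q; rewrite !inE => /or3P[/eqP->|/eqP->|ps] /or3P[/eqP->|/eqP->|qs] /=;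
      rewrite ?ltxx ?xy ?lu ?(lt_gtF xy) ?(lt_gtF lu) //;
      by [have [] := xl _ qs|have [] := yu _ qs|have [] := xl _ ps|have [] := yu _ ps|exact: os].
  (* Of three values available as images near the cut, either the lower two or the upper two lie on
     the same side of the cut moved by [rep n]. *)
  have [z1 [z1l z1u]] : exists z, (forall b, b \in below -> b < z) /\
      forall b, b \in above -> z < b.
    apply: rat_saturated => l u /mapP[p]; rewrite mem_filter => /andP[/asboolP Lp ps] ->.
    by move=> /mapP[q]; rewrite mem_filter => /andP[/asboolPn Uq qs] ->; exact: LUs.
  have [z2 [z2l z2u]] := @rat_saturated [:: z1] above
    ltac:(by move=> l u; rewrite inE => /eqP -> /z1u).
  have [z3 [z3l z3u]] := @rat_saturated [:: z2] above
    ltac:(by move=> l u; rewrite inE => /eqP -> /z2u).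
  have z12 : z1 < z2 by apply: z2l; rewrite inE.
  have z23 : z2 < z3 by apply: z3l; rewrite inE.
  have cx : c < x by exact: (xs (c, c) cs).
  have yd : y < d by exact: (ys (d, d) ds).
  have Ln := aut_on_aut (repP n).1; have aLn := aut_inv Ln.
  have [L2|U2] := pselect (L (inv (rep n) z2)).
    exists [:: (x, z1); (y, z2)]; split; first exact: between.
    exists (x, z1), (y, z2); rewrite !inE !eqxx !orbT; split=> //=; split=> // _.
    by apply: lowL L2 _; rewrite aut_le // ltW.
  exists [:: (x, z2); (y, z3)]; split.
    by apply: between => // b /z1l /lt_trans; apply.
  exists (x, z2), (y, z3); rewrite !inE !eqxx !orbT; split=> //=; split=> // L3.
  by case: U2; apply: lowL L3 _; rewrite aut_le // ltW.
have af : aut f by split=> //; exists f'.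
have [||g [Ag gE]] := @restrict_itv f c d af.
- by apply: (fs (c, c)); rewrite !inE eqxx.
- by apply: (fs (d, d)); rewrite !inE eqxx orbT.
pose n := pickle (act g w).
have [t [[p [q [pt qt [cp Lp] [Uq qd] pq]]] tf]] := fE n.
have gp : g p.1 = p.2 by rewrite gE ?tf // /itv cp; exact: LU Lp Ud.
have gq : g q.1 = q.2 by rewrite gE ?tf // /itv qd andbT; exact: LU Lc Uq.
have [Ar rn] := repP n; have ar := aut_on_aut Ar; have air := aut_inv ar.
have ag := aut_on_aut Ag.
have rw : act (rep n) w = act g w by apply: (pcan_inj pickleK); exact: rn Ag _.
have Ah : aut_on (itv c d) (inv (rep n) \o g) by exact: aut_on_comp (aut_on_inv Ar) Ag.
have hw : act (inv (rep n) \o g) w = w by rewrite (actP.2 _ g) // -rw act_inv.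
(* The images of [p.1] and [q.1] are on the same side: if below the cut, then [q.1] has been moved
   down; if above, the inverse moves the image of [p.1] down. *)
have [Lhq|Uhq] := pselect (L (inv (rep n) q.2)).
  by exists (inv (rep n) \o g), q.1; split=> //=; rewrite gq.
have ah := aut_on_aut Ah.
exists (inv (inv (rep n) \o g)), ((inv (rep n) \o g) p.1); split.
- exact: aut_on_inv.
- exact: act_fix_inv.
- by rewrite /= gp => /pq.
- by rewrite invK.
Qed.

(** A supremum argument: let [L] consist of the [x] such that maps supported below [x] have a finite
    support condition. Left and right germs show that [L] is nonempty, has no greatest element and,
    if it does not give the claim, is bounded by a complement without least element.
    [insensitive_cut] then leads beyond this cut. *)
Lemma small_index : exists F, support act w F.
Proof.
pose PP (Y : set rat) := exists F : seq rat, forall g, aut_on Y g ->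
  (forall x, x \in F -> g x = x) -> act g w = w.
(* Adding [c] to the finite set splits the map at [c]; the part above [c] is supported in the
   insensitive set [X]. *)
have PPS c (X Y : set rat) : PP (fun x => x < c) -> insensitive X ->
    (forall x, Y x -> c < x -> X x) -> PP Y.
  move=> [F FP] gX YX; exists (c :: F) => g Ag gF; have ag := aut_on_aut Ag.
  have gc : g c = c by apply: gF; rewrite inE eqxx.
  have {}gF x : x \in F -> g x = x by move=> xF; apply: gF; rewrite inE xF orbT.
  have [g1 [g2 [Ag1 Ag2 e g1E g2E]]] := aut_split_lt ag gc.
  rewrite e; apply: (act_fix_comp actP (aut_on_aut Ag1) (aut_on_aut Ag2)).
    apply: FP => // x xF; have [xc|nxc] := pselect (x < c); last exact: Ag1.2.
    by rewrite g1E // gF.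
  apply: gX; split=> [|x nX]; first exact: aut_on_aut Ag2.
  have [xc|nxc] := pselect (x < c); first by apply: Ag2.2 => /(_ xc).
  rewrite g2E //; move/negP: nxc; rewrite -leNgt le_eqVlt => /orP[/eqP <- //|cx].
  by apply: Ag.2 => /YX /(_ cx).
have lowL x y : PP (fun z => z < y) -> x <= y -> PP (fun z => z < x).
  move=> [F FP] xy; exists F => g Ag; apply: FP; apply: aut_on_sub Ag => z zx.
  exact: lt_le_trans xy.
suff [F FP] : PP (fun=> True) by exists F => g ag; apply: FP.
apply: contrapT => nT; pose L x := PP (fun z => z < x).
have [|||d0 [_ gd0]] := @insensitive_right_germ (fun=> True); rewrite ?/setT //.
- by exists 0.
- by move=> x _; exists (x - 1); split=> //; lra.
have neL : exists x, L x.
  by exists d0, [::] => g Ag _; apply: gd0; apply: aut_on_sub Ag.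
have opL x : L x -> exists y, L y /\ x < y.
  move=> Lx; have [|||d [xd gd]] := @insensitive_right_germ (fun y => x < y).
  - by move=> y z; exact: lt_le_trans.
  - by exists (x + 1); lra.
  - by move=> y xy; exists ((x + y) / 2); lra.
  by exists d; split=> //; apply: (PPS x _ _ Lx gd).
have [c [Lc gc]] := insensitive_left_germ w actP lowL neL opL.
have neU : exists x, ~ L x.
  apply/existsNP => allL; apply: nT; apply: (PPS c _ _ Lc gc) => x _ cx.
  by split=> //; exact: allL.
have opU x : ~ L x -> exists y, ~ L y /\ y < x.
  move=> nLx; apply: contrapT => /forallNP H; apply: nLx.
  apply: (PPS c _ _ Lc gc) => y yx cy; split=> //.
  by apply: contrapT => nLy; apply: (H y).
have [c' [d [Lc' nLd gcd]]] := insensitive_cut lowL neL opL neU opU.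
apply: nLd; apply: (PPS c' _ _ Lc' gcd) => x xd cx.
by rewrite /itv cx.
Qed.

(** Let [I] be the component around [f] of the complement of the other points of [F]. Its parts left
    and right of [f] avoid [F], and some neighbourhood of [f] is insensitive; these three
    overlapping pieces merge to [I]. *)
Lemma support_remove F f : support act w F -> ~ essential act w f ->
  support act w [seq x <- F | x != f].
Proof.
move=> sF /existsNP [a /existsNP [b /not_implyP [/andP[af fb] /contrapT gab]]] g ag gF.
pose F' := [seq x <- F | x != f].
pose I : set rat := fun x => forall p, p \in F' -> (p < f -> p < x) /\ (f < p -> x < p).
have If : I f by [].
have cI : convex I.
  move=> x y z Ix Iz /andP[xy yz] p pF; split=> h.
    exact: lt_le_trans ((Ix _ pF).1 h) xy.
  exact: le_lt_trans yz ((Iz _ pF).2 h).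
have oI x e : I x -> e < x -> exists y, [/\ I y, e < y & y < x].
  move=> Ix ex; have [|y [ly yu]] :=
      @rat_saturated (e :: [seq p <- F' | p < f]) [:: x].
    move=> l u; rewrite !inE mem_filter => /orP[/eqP->|/andP[lf lF]] /eqP-> //.
    exact: (Ix _ lF).1.
  have yx : y < x by apply: yu; rewrite inE.
  exists y; split=> //; last by apply: ly; rewrite inE eqxx.
  move=> p pF; split=> h; last exact: lt_trans yx ((Ix _ pF).2 h).
  by apply: ly; rewrite inE mem_filter h pF orbT.
have oI' x e : I x -> x < e -> exists y, [/\ I y, x < y & y < e].
  move=> Ix xe; have [|y [ly yu]] :=
      @rat_saturated [:: x] (e :: [seq p <- F' | f < p]).
    move=> l u; rewrite !inE mem_filter => /eqP-> /orP[/eqP->//|/andP[lf lF]].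
    exact: (Ix _ lF).2.
  have yx : x < y by apply: ly; rewrite inE.
  exists y; split=> //; last by apply: yu; rewrite inE eqxx.
  move=> p pF; split=> h; first exact: lt_trans ((Ix _ pF).1 h) yx.
  by apply: yu; rewrite inE mem_filter h pF orbT.
have gI (X : set rat) : (forall x, X x -> I x /\ x != f) -> insensitive X.
  move=> XI k Ak; apply: (sF _ (aut_on_aut Ak)) => x xF; apply: Ak.2 => /XI [Ix xf].
  have /Ix [h1 h2] : x \in F' by rewrite mem_filter xf.
  move: xf; rewrite neq_lt => /orP[/h1|/h2]; by rewrite ltxx.
have [u [Iu au uf]] := oI _ _ If af; have [v [Iv fv vb]] := oI' _ _ If fb.
have oab : open_convex (fun x => I x /\ itv a b x).
  split=> [x y z [Ix /andP[ax _]] [Iz /andP[_ zb]] xyz|x [Ix /andP[ax xb]]].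
    split; first exact: cI xyz.
    by case/andP: xyz => xy yz; rewrite /itv (lt_le_trans ax) // (le_lt_trans yz).
  have [y [Iy ay yx]] := oI _ _ Ix ax; have [z [Iz xz zb]] := oI' _ _ Ix xb.
  by exists y, z; split; [split=> //; rewrite /itv; lra|split=> //; rewrite /itv; lra|rewrite yx].
have ol : open_convex (fun x => I x /\ x < f).
  split=> [x y z [Ix xf] [Iz zf] xyz|x [Ix xf]].
    by split; [exact: cI xyz|case/andP: xyz => _ yz; exact: le_lt_trans zf].
  have [y [Iy _ yx]] := oI x (x - 1) Ix ltac:(lra); have [z [Iz xz zf]] := oI' _ _ Ix xf.
  by exists y, z; split; [split=> //; exact: lt_trans xf|split|rewrite yx].
have or : open_convex (fun x => I x /\ f < x).
  split=> [x y z [Ix fx] [Iz fz] xyz|x [Ix fx]].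
    by split; [exact: cI xyz|case/andP: xyz => xy _; exact: lt_le_trans xy].
  have [y [Iy fy yx]] := oI _ _ Ix fx; have [z [Iz xz _]] := oI' x (x + 1) Ix ltac:(lra).
  by exists y, z; split; [split|split=> //; exact: lt_trans xz|rewrite yx].
have g1 : insensitive (fun x => (I x /\ x < f) \/ (I x /\ itv a b x)).
  apply: (insensitive_merge (u := u)) => //.
  - by split=> //; rewrite /itv; lra.
  - by move=> x [Ix _] xu; split=> //; lra.
  - by move=> x [Ix xf] ux; split=> //; rewrite /itv; lra.
  - by apply: gI => x [Ix xf]; rewrite lt_eqF.
  - by apply: insensitive_sub gab => x [].
have gII : insensitive I.
  apply: (@insensitive_sub _ _ _ _ (fun x => ((I x /\ x < f) \/ (I x /\ itv a b x)) \/ (I x /\ f < x))).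
    move=> x Ix; case: (ltgtP x f) => [xf|fx|->]; [by left; left|by right|].
    by left; right; rewrite /itv af.
  apply: (insensitive_merge (u := v)) => //.
  - split=> [x y z xX zX xyz|x].
      have Iy : I y by apply: cI xyz; [case: xX => -[]|case: zX => -[]].
      case: (ltP y f) => yf; [by left|right; split=> //].
      case: zX => -[_]; [|rewrite /itv]; case/andP: xyz => _ yz; first lra.
      by move=> /andP[_ zb]; rewrite (lt_le_trans af) // (le_lt_trans yz).
    move=> [] h.
      by have [y [z [Iy Iz yz]]] := ol.2 _ h; exists y, z; split=> //; left.
    by have [y [z [Iy Iz yz]]] := oab.2 _ h; exists y, z; split=> //; right.
  - by right; split=> //; rewrite /itv; lra.
  - by move=> x [Ix fx] xv; right; split=> //; rewrite /itv; lra.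
  - by move=> x [[Ix _]|[Ix _]] vx; split=> //; lra.
  - by apply: gI => x [Ix xf]; rewrite gt_eqF.
have gF' p : p \in F' -> g p = p by exact: gF.
have [|k1 [k2 [Ak1 Ak2 e _ k2E]]] := @aut_split g I ag.
  move=> x Ix; exists I; split=> // y.
  have e1 p : p \in F' -> (p < g y) = (p < y).
    by move=> pF; rewrite -[in LHS](gF' _ pF) aut_lt.
  have e2 p : p \in F' -> (g y < p) = (y < p).
    by move=> pF; rewrite -[in LHS](gF' _ pF) aut_lt.
  by split=> h p pF; have := h _ pF; rewrite e1 ?e2.
rewrite e; apply: (act_fix_comp actP (aut_on_aut Ak1) (aut_on_aut Ak2)); first exact: gII.
apply: (sF _ (aut_on_aut Ak2)) => x xF.
have [Ix|nIx] := pselect (I x); first by apply: Ak2.2 => /(_ Ix).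
rewrite k2E //; apply: gF; rewrite mem_filter xF andbT.
by apply/eqP => xf; apply: nIx; rewrite xf.
Qed.

End Point.

Lemma essential_support w : exists F, support act w F /\ forall x, x \in F -> essential act w x.
Proof.
have [F0] := small_index w; elim: {F0}(size F0).+1 {-2}F0 (ltnSn (size F0)) => // n IH F.
rewrite ltnS => sF FP.
have [[f [fF nf]]|H] := pselect (exists f, f \in F /\ ~ essential act w f); last first.
  by exists F; split=> // x xF; apply: contrapT => nx; apply: H; exists x.
apply: IH (support_remove FP nf); apply: leq_trans sF.
by rewrite size_filter -(count_predC (pred1 f) F) addnC -addn1 leq_add2l -has_count has_pred1.
Qed.

(** A point outside the finite set [F] has an interval around it that avoids [F]. *)
Lemma essential_in_support w F x : support act w F -> essential act w x -> x \in F.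
Proof.
move=> sF ex; apply: contrapT => /negP xF.
have [|a [la au]] := @rat_saturated [seq p <- F | p < x] [:: x].
  by move=> l u; rewrite inE mem_filter => /andP[lx _] /eqP->.
have [|b [lb bu]] := @rat_saturated [:: x] [seq p <- F | x < p].
  by move=> l u; rewrite inE mem_filter => /eqP-> /andP[lx _].
apply: (ex a b); first by rewrite /itv au ?lb ?inE.
move=> k Ak; apply: (sF _ (aut_on_aut Ak)) => p pF; apply: Ak.2 => /andP[h1 h2].
case: (ltgtP p x) => h.
- by have := la p; rewrite mem_filter h pF => /(_ isT) /lt_trans /(_ h1); rewrite ltxx.
- by have := bu p; rewrite mem_filter h pF => /(_ isT) /lt_trans /(_ h2); rewrite ltxx.
- by rewrite -h pF in xF.
Qed.

End Support.

(** * Reconstruction for monoids of injections *)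

(* The image of [g0] is [rat * {0}] inside [rat * rat], ordered lexicographically. *)
Lemma sparse_embedding : exists g0 : rat -> rat,
  [/\ forall x y, x < y -> g0 x < g0 y,
    forall S : set rat, exists a, aut a /\
      forall z, a z = z <-> exists x, S x /\ z = g0 x &
    forall u, exists v1 v2, [/\ v1 < g0 u, g0 u < v2, forall x, g0 x <> v1 &
      forall x, g0 x <> v2]].
Proof.
have up (x : rat) : x < x + 1 by lra.
have down (x : rat) : x - 1 < x by lra.
have mid (x y : rat) : x < y -> x < (x + y) / 2 /\ (x + y) / 2 < y by lra.
have mul2K (x : rat) : 2 * x / 2 = x by lra.
have mul2VK (x : rat) : 2 * (x / 2) = x by lra.
have mul2_lt (x y : rat) : x < y -> 2 * x < 2 * y by lra.
have mul2_id (x : rat) : 2 * x = x -> x = 0 by lra.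
have add1_id (x : rat) : x + 1 = x -> False by lra.
pose T := (rat *l rat)%type.
have ltT (x y : T) : (x < y)%O = (x.1 < y.1) || ((x.1 == y.1) && (x.2 < y.2)).
  case: x y => [x1 x2] [y1 y2]; rewrite ltxi_pair /=.
  by case: (ltgtP x1 y1).
have satT : saturated T.
  apply: (@dense_saturated _ T (0, 0)) => [[x1 x2] [y1 y2]|[x1 x2]|[x1 x2]].
  - rewrite ltT /= => /orP[xy|/andP[/eqP-> xy]].
      by exists (x1, x2 + 1); rewrite !ltT /= xy eqxx up orbT.
    by exists (y1, (x2 + y2) / 2); rewrite !ltT /= eqxx ltxx /=; exact: mid.
  - by exists (x1, x2 + 1); rewrite ltT /= eqxx up orbT.
  - by exists (x1, x2 - 1); rewrite ltT /= eqxx down orbT.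
pose enumT n : T := odflt (0, 0) (unpickle n : option (rat * rat)).
have enumTP x : exists n, enumT n = x.
  by exists (pickle (x : rat * rat)); rewrite /enumT pickleK.
have [| |th [th' [thK thVK thi _ _]]] := @back_and_forth _ _ rat T enum_rat enumT [::]
    (fun _ _ => True) rat_saturated satT enum_ratP enumTP.
- by [].
- by move=> _ s os _; exists [::].
have th'i x y : (x < y)%O -> th' x < th' y.
  move=> xy; rewrite ltNge le_eqVlt; apply/negP => /orP[/eqP/(can_inj thVK) e|/thi].
    by move: xy; rewrite e ltxx.
  by rewrite !thVK lt_gtF.
pose g0 x := th' (x, 0); exists g0; split.
- by move=> x y xy; apply: th'i; rewrite ltT /= xy.
- move=> S.
  (* In the fibres over [S] doubling fixes exactly the zero; in the other fibres the translation
     fixes nothing. *)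
  pose f (p : T) : T := if pselect (S p.1) then (p.1, 2 * p.2) else (p.1, p.2 + 1).
  pose f' (p : T) : T := if pselect (S p.1) then (p.1, p.2 / 2) else (p.1, p.2 - 1).
  have ff' : cancel f f'.
    by move=> [x y]; rewrite /f /f' /=; case: pselect => Sx /=; case: pselect => // ?;
      rewrite ?mul2K ?mul2VK ?addrK ?subrK.
  have f'f : cancel f' f.
    by move=> [x y]; rewrite /f /f' /=; case: pselect => Sx /=; case: pselect => // ?;
      rewrite ?mul2K ?mul2VK ?addrK ?subrK.
  have fi p q : (p < q)%O -> (f p < f q)%O.
    case: p q => [x y] [x' y']; rewrite !ltT /f /=.
    case/orP=> [h|/andP[/eqP-> h]].
      by case: pselect; case: pselect => /= _ _; rewrite h.
    by case: pselect => /= _; rewrite eqxx ltxx /= ?ltrD2r ?mul2_lt.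
  exists (th' \o f \o th); split.
    split=> [x y /thi/fi/th'i //|]; exists (th' \o f' \o th).
    by split=> x /=; rewrite thVK ?ff' ?f'f ?thK.
  move=> z; split=> [/= e|[x [Sx ->]]]; last first.
    by rewrite /g0 /= thVK /f /=; case: pselect => //= _; rewrite mulr0.
  have {}e : f (th z) = th z by apply: (can_inj thVK); rewrite thK.
  exists (th z).1; have thz : th z = ((th z).1, (th z).2) by case: (th z).
  move: e; rewrite {1}/f; case: pselect => [Sx|nSx] e; last first.
    by have /= /add1_id := congr1 snd e.
  split=> //; rewrite /g0 -[LHS]thK; congr th'; rewrite [LHS]thz; congr (_, _).
  by have /= /mul2_id := congr1 snd e.
- move=> u; exists (th' (u, -1)), (th' (u, 1)); split.
  + by apply: th'i; rewrite ltT /= eqxx ltxx.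
  + by apply: th'i; rewrite ltT /= eqxx ltxx.
  + by move=> x /(can_inj thVK) [].
  + by move=> x /(can_inj thVK) [].
Qed.

(** * From the small index property of the units to continuity of the action *)

Definition is_unit (M : set (rat -> rat)) g h : Prop :=
  [/\ M g, M h, cancel g h & cancel h g].

Definition monoid_action (M : set (rat -> rat)) (T : Type)
    (act : (rat -> rat) -> T -> T) : Prop :=
  (forall w, act idfun w = w) /\
  forall f g w, M f -> M g -> act (f \o g) w = act f (act g w).

(** The common interface of the three monoids: units have the small index property and are dense. By
    [rec_local], conjugation by a unit, which may fail to preserve the order, turns automorphisms
    supported near [g x] into automorphisms supported near [x]. *)
Record reconstructible (M : set (rat -> rat)) : Prop := Reconstructible {
  rec_inj : forall f, M f -> injective f;
  rec_comp : forall f g, M f -> M g -> M (f \o g);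
  rec_incr : forall f : rat -> rat, (forall x y, x < y -> f x < f y) -> M f;
  rec_small_index : forall (Omega : countType) (act : (rat -> rat) -> Omega -> Omega) w,
    monoid_action M act -> exists F : seq rat, forall g h, is_unit M g h ->
      (forall x, x \in F -> g x = x) -> act g w = w;
  rec_dense : forall m (F : seq rat), M m ->
    exists g h, is_unit M g h /\ forall x, x \in F -> g x = m x;
  rec_local : forall g h a b x, is_unit M g h -> itv a b x ->
    exists a' b', itv a' b' (g x) /\
      forall r, aut_on (itv a' b') r -> aut_on (itv a b) (h \o r \o g) }.

Section Reconstruction.
Variables (M : set (rat -> rat)) (Omega : countType).
Variable act : (rat -> rat) -> Omega -> Omega.
Hypotheses (recM : reconstructible M) (actP : monoid_action M act).
(** For a clone isomorphism, [act_inj] comes from its injectivity and [act_closed] from the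
    closedness of its image. *)
Hypothesis act_inj : forall f g, M f -> M g -> (forall w, act f w = act g w) -> f = g.
Hypothesis act_closed : forall k : Omega -> Omega,
  (forall W : seq Omega, exists f, M f /\ forall w, w \in W -> act f w = k w) ->
  exists f, M f /\ forall w, act f w = k w.

Lemma aut_M f : aut f -> M f.
Proof. by case=> fi _; exact: rec_incr recM _ fi. Qed.

Lemma aut_unit f : aut f -> is_unit M f (inv f).
Proof.
move=> af; split; [exact: aut_M|exact/aut_M/aut_inv|exact: invK|exact: invVK].
Qed.

Lemma unit_inv g h : is_unit M g h -> is_unit M h g.
Proof. by case. Qed.

Lemma unit_comp g h g' h' : is_unit M g h -> is_unit M g' h' ->
  is_unit M (g \o g') (h' \o h).
Proof.
move=> [Mg Mh gh hg] [Mg' Mh' gh' hg'].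
split; [exact: rec_comp|exact: rec_comp|exact: can_comp|exact: can_comp].
Qed.

Lemma act_unitK g h w : is_unit M g h -> act h (act g w) = w.
Proof.
move=> [Mg Mh gh hg]; rewrite -(actP.2 h g) // (_ : h \o g = idfun) ?actP.1 //.
exact/funext.
Qed.

Lemma aut_action : action act.
Proof. by split=> [|f g w /aut_M Mf /aut_M Mg]; [exact: actP.1|exact: actP.2]. Qed.

Lemma unit_support : exists Fw : Omega -> seq rat, forall w g h g' h',
  is_unit M g h -> is_unit M g' h' -> (forall x, x \in Fw w -> g x = g' x) ->
  act g w = act g' w.
Proof.
have /choice [Fw FwP] := fun w => rec_small_index recM w actP.
exists Fw => w g h g' h' ug ug' gg'.
have [Mg _ _ _] := ug; have [_ Mh' gh' _] := ug'.
have e : act (h' \o g) w = w.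
  by apply: FwP (unit_comp (unit_inv ug') ug) _ => x xF /=; rewrite gg' // gh'.
by rewrite (actP.2 h' g) // in e; rewrite -(act_unitK (act g w) (unit_inv ug')) e.
Qed.

Definition fixes_units (phi : (rat -> rat) -> rat -> rat) : Prop :=
  [/\ forall m, M m -> M (phi m), forall a, aut a -> phi a = a &
    forall f g, M f -> M g -> phi (f \o g) = phi f \o phi g].

Lemma rigid phi : fixes_units phi -> forall m, M m -> phi m = m.
Proof.
move=> [phiM phia phic].
have [g0 [g0i Fix sp]] := sparse_embedding.
have Mg0 : M g0 := rec_incr recM g0i.
have g0inj := rec_inj recM Mg0.
have phi_im f x : M f -> exists y, phi (g0 \o f) x = g0 (f y).
  move=> Mf; have [a [aa aF]] := Fix (fun y => exists z, y = f z).
  have Mgf : M (g0 \o f) by exact: rec_comp.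
  have e : a \o (g0 \o f) = g0 \o f.
    by apply/funext => z /=; apply/aF; exists (f z); split=> //; exists z.
  have := phic _ _ (aut_M aa) Mgf; rewrite e (phia a aa) => e'.
  have /aF [_ [[z ->] ->]] : a (phi (g0 \o f) x) = phi (g0 \o f) x by rewrite {2}e'.
  by exists z.
(* The image of [g0] has gaps on both sides of each of its points, so an automorphism can move it to
   contain [a] and miss [b]. *)
have gamma u a b : a <> b -> exists c v, [/\ aut c, c (g0 u) = a, c v = b &
    forall x, g0 x <> v].
  move=> ab; have [v1 [v2 [v1u uv2 n1 n2]]] := sp u.
  case: (ltgtP a b) => [lt|lt|//].
    have [|c [ac cs]] := @finite_extension [:: (g0 u, a); (v2, b)].
      by move=> p q; rewrite !inE => /orP[]/eqP-> /orP[]/eqP-> /=;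
        rewrite ?ltxx ?lt ?uv2 // (lt_gtF lt) (lt_gtF uv2).
    exists c, v2; split=> //; first by apply: (cs (g0 u, a)); rewrite !inE eqxx.
    by apply: (cs (v2, b)); rewrite !inE eqxx orbT.
  have [|c [ac cs]] := @finite_extension [:: (g0 u, a); (v1, b)].
    by move=> p q; rewrite !inE => /orP[]/eqP-> /orP[]/eqP-> /=;
      rewrite ?ltxx ?lt ?v1u // (lt_gtF lt) (lt_gtF v1u).
  exists c, v1; split=> //; first by apply: (cs (g0 u, a)); rewrite !inE eqxx.
  by apply: (cs (v1, b)); rewrite !inE eqxx orbT.
have phig0 : phi g0 = g0.
  have Mid : M idfun by apply: aut_M; exact: aut_id.
  have /choice [h hP] := fun x => phi_im idfun x Mid.
  have {}hP x : phi g0 x = g0 (h x) by rewrite -hP.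
  (* If [h] moves [a], choose [c] such that [c \o g0] takes the value [a] at [h 0] but never the
     value [h a]. Evaluating [phi (g0 \o (c \o g0))] at 0 gives [g0 (h a)], which has to be a value
     of [g0 \o (c \o g0)]. *)
  suff hid a : h a = a by apply/funext => x; rewrite hP hid.
  apply: contrapT => /nesym ha; have [c [v [ac cu cv nv]]] := gamma (h 0) _ _ ha.
  have Mc := aut_M ac; have Mcg : M (c \o g0) by exact: rec_comp.
  have [y] := phi_im _ 0 Mcg; rewrite (phic g0) // (phic c) // (phia c ac) /= !hP cu => /g0inj.
  by rewrite -cv => /(aut_inj ac) /esym; exact: nv.
move=> f Mf.
have im x : exists y, phi f x = f y.
  by have [y] := phi_im f x Mf; rewrite (phic g0) // phig0 => /g0inj; exists y.
have /choice [h hP] := im.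
(* The same argument, now with [f] inserted between [g0] and [c \o g0]. *)
suff hid a : h a = a by apply/funext => x; rewrite hP hid.
apply: contrapT => /nesym ha; have [c [v [ac cu cv nv]]] := gamma 0 _ _ ha.
have Mc := aut_M ac; have Mcg : M (c \o g0) by exact: rec_comp.
have Mfcg : M (f \o (c \o g0)) by exact: rec_comp.
have [y] := phi_im _ 0 Mfcg.
rewrite (phic g0) // phig0 (phic f) // (phic c) // phig0 (phia c ac) /= hP cu => /g0inj /(rec_inj recM Mf).
by rewrite -cv => /(aut_inj ac) /esym; exact: nv.
Qed.

(* The limits of the action of units approximating [m] define, by closedness,
   an endomorphism of [M] that fixes the units; it is the identity. *)
Lemma act_limit : exists Fw : Omega -> seq rat, forall w m g h, M m -> is_unit M g h ->
  (forall x, x \in Fw w -> g x = m x) -> act m w = act g w.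
Proof.
have [Fw FwP] := unit_support; exists Fw.
have lim m : exists k, M m -> M k /\ forall w g h, is_unit M g h ->
    (forall x, x \in Fw w -> g x = m x) -> act k w = act g w.
  have [Mm|] := pselect (M m); last by exists m.
  have /choice [g gP] := fun w => rec_dense recM (Fw w) Mm.
  have [|k [Mk kE]] := @act_closed (fun w => act (g w) w).
    move=> W; have [g' [h' [ug' g'm]]] := rec_dense recM (flatten (map Fw W)) Mm.
    exists g'; split=> [|w wW]; first by case: ug'.
    have [h [ug gm]] := gP w; apply: FwP ug' ug _ => x xF; rewrite gm // g'm //.
    by apply/flattenP; exists (Fw w) => //; exact: map_f.
  exists k => _; split=> // w g' h' ug' g'm; rewrite kE.
  by have [h [ug gm]] := gP w; apply: FwP ug ug' _ => x xF; rewrite gm // g'm.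
have /choice [phi phiP] := lim.
have phiM m : M m -> M (phi m) by move=> /phiP [].
suff H m : M m -> phi m = m.
  by move=> w m g h Mm ug gm; rewrite -{1}(H m Mm); exact: (phiP m Mm).2 ug gm.
apply: rigid; split=> // [a aa|f g Mf Mg].
  have Ma := aut_M aa; apply: act_inj => //; first exact: phiM.
  by move=> w; apply: (phiP a Ma).2 (aut_unit aa) _.
have Mfg : M (f \o g) by exact: rec_comp.
apply: act_inj; [exact: phiM|by apply: (rec_comp recM); exact: phiM|move=> w].
have [g1 [h1 [u1 g1E]]] := rec_dense recM (Fw w) Mg.
rewrite (actP.2 (phi f) (phi g)); [|exact: phiM|exact: phiM].
rewrite ((phiP g Mg).2 _ _ _ u1 g1E).
(* [g2] approximates [f] where [phi f] acts on the moved point, and also on the values of [g], so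
   that [g2 \o g1] approximates [f \o g]. *)
have [g2 [h2 [u2 g2E]]] := rec_dense recM (Fw (act g1 w) ++ map g (Fw w)) Mf.
have e2 x : x \in Fw (act g1 w) -> g2 x = f x by move=> xF; apply: g2E; rewrite mem_cat xF.
rewrite ((phiP f Mf).2 _ _ _ u2 e2).
rewrite ((phiP _ Mfg).2 w _ _ (unit_comp u2 u1)); first by apply: actP.2; [case: u2|case: u1].
by move=> x xF; rewrite /= g1E // g2E // mem_cat map_f ?orbT.
Qed.

Lemma act_continuous w : exists F : seq rat, forall m m', M m -> M m' ->
  (forall x, x \in F -> m x = m' x) -> act m w = act m' w.
Proof.
have [Fw FwP] := act_limit; exists (Fw w) => m m' Mm Mm' mm'.
have [g [h [ug gm]]] := rec_dense recM (Fw w) Mm.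
rewrite (FwP _ _ _ _ Mm ug gm) (FwP _ _ _ _ Mm' ug) // => x xF.
by rewrite gm ?mm'.
Qed.

Lemma essential_unit g h w x : is_unit M g h -> essential act w x ->
  essential act (act g w) (g x).
Proof.
move=> ug ex a b gab gd; have uh := unit_inv ug.
have [a' [b' [x' rP]]] := rec_local recM uh gab.
have [Mg Mh gh _] := ug; rewrite gh in x'; apply: (ex a' b' x') => r Ar.
have Mr := aut_M (aut_on_aut Ar); have Mgr : M (g \o r) by exact: rec_comp.
have := gd _ (rP _ Ar); rewrite (actP.2 (g \o r) h) // (act_unitK _ ug).
by rewrite (actP.2 g r) // => /(congr1 (act h)); rewrite !(act_unitK _ ug).
Qed.

(** Replace [m] by a unit that acts in the same way on [w] and agrees with [m] on the finite set of
    essential points; units transport essential points. *)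
Lemma essential_act m w y : M m ->
  essential act (act m w) y <-> exists x, essential act w x /\ y = m x.
Proof.
move=> Mm; have [Fw FwP] := act_limit.
have [E [sE EE]] := essential_support aut_action w.
have [g [h [ug gm]]] := rec_dense recM (Fw w ++ E) Mm.
have gE x : essential act w x -> g x = m x.
  by move=> /(essential_in_support sE) xE; apply: gm; rewrite mem_cat xE orbT.
rewrite (FwP w m g h) //; last by move=> x xF; apply: gm; rewrite mem_cat xF.
split=> [ey|[x [ex ->]]]; last by rewrite -gE //; exact: essential_unit ug ex.
have := essential_unit (unit_inv ug) ey; rewrite (act_unitK _ ug) => ehy.
by exists (h y); split=> //; rewrite -gE //; case: ug.
Qed.

(** Without essential points all supports are empty, and the translation by 1 acts like the
    identity, against faithfulness. *)
Lemma essential_exists : exists w x, essential act w x.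
Proof.
apply: contrapT => H.
have : (fun x : rat => x + 1) = idfun.
  have a1 : aut (fun x : rat => x + 1).
    by split=> [x y|]; [lra|exists (fun x => x - 1); split=> x; rewrite ?addrK ?subrK].
  apply: act_inj => [||w]; [exact: aut_M|exact/aut_M/aut_id|rewrite actP.1].
  have [F [sF FE]] := essential_support aut_action w; apply: sF => // x /FE ex.
  by case: H; exists w, x.
by move=> /(congr1 (fun f => f 0)) /=; lra.
Qed.

(* Translations moving the least and the greatest essential point of a point of
   [Omega] to [q] make [q] the only common essential point of the translates. *)
Lemma act_open q : exists W : seq Omega, forall m m', M m -> M m' ->
  (forall w, w \in W -> act m w = act m' w) -> m q = m' q.
Proof.
have [w [e ew]] := essential_exists.
have [E [sE EE]] := essential_support aut_action w.
have eE := essential_in_support sE ew.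
have [E0|[lo loE lomin]] := min_seq E; first by rewrite E0 in eE.
have [E0|[hi hiE himax]] := max_seq E; first by rewrite E0 in eE.
have at_ c : aut (fun x : rat => x + c).
  by split=> [x y|]; [lra|exists (fun x => x - c); split=> x; rewrite ?addrK ?subrK].
pose t1 (x : rat) := x + (q - lo); pose t2 (x : rat) := x + (q - hi).
have [a1 a2] : aut t1 /\ aut t2 by split; exact: at_.
exists [:: act t1 w; act t2 w] => m m' Mm Mm' mm'.
have key t x0 : aut t -> t x0 = q -> x0 \in E -> act m (act t w) = act m' (act t w) ->
    exists x, x \in E /\ m q = m' (t x).
  move=> at' tx0 x0E mt; have eq : essential act (act t w) q.
    by apply/(essential_act _ _ (aut_M at')); exists x0; split=> //; exact: EE.
  have : essential act (act m (act t w)) (m q) by apply/essential_act => //; exists q.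
  rewrite mt => /(essential_act _ _ Mm') [y [/(essential_act _ _ (aut_M at')) [x [ex ->]] ->]].
  by exists x; split=> //; exact: essential_in_support sE ex.
have [||x [xE mx]] := key t1 lo a1 _ loE _; first by rewrite /t1; lra.
  by apply: mm'; rewrite inE eqxx.
have [||y [yE my]] := key t2 hi a2 _ hiE _; first by rewrite /t2; lra.
  by apply: mm'; rewrite !inE eqxx orbT.
(* As [lo <= x] and [y <= hi], [t1 x] is at least [q] and [t2 y] at most [q]; being equal, both are
   [q]. *)
have e' : t1 x = t2 y by apply: (rec_inj recM Mm'); rewrite -mx -my.
have h1 := lomin _ xE; have h2 := himax _ yE.
rewrite mx; congr m'; move: e'; rewrite /t1 /t2; lra.
Qed.

End Reconstruction.

(** * Betweenness, circular order and separation *)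

Lemma increasing_betw (f : rat -> rat) : (forall x y, x < y -> f x < f y) -> Emb3 betw f.
Proof.
move=> fi; have fle x y : x <= y -> f x <= f y.
  by rewrite !le_eqVlt => /orP[/eqP->|/fi ->]; rewrite ?eqxx ?orbT.
split=> [x y e|x y z].
  by case: (ltgtP x y) => // /fi; rewrite e ltxx.
by rewrite /betw => /orP[]/andP[/fle -> /fle ->]; rewrite ?orbT.
Qed.

Lemma oppr_betw : Emb3 betw (@GRing.opp rat).
Proof.
split=> [x y /oppr_inj //|x y z]; rewrite /betw !lerN2.
by case/orP=> /andP[-> ->]; rewrite ?orbT.
Qed.

Lemma increasing_circ (f : rat -> rat) : (forall x y, x < y -> f x < f y) -> Emb3 circ f.
Proof.
move=> fi; have [finj _] := increasing_betw fi; have fle x y : x <= y -> f x <= f y.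
  by rewrite !le_eqVlt => /orP[/eqP->|/fi ->]; rewrite ?eqxx ?orbT.
split=> // x y z; rewrite /circ.
by move=> /or3P[]/andP[/fle -> /fle ->]; rewrite ?orbT.
Qed.

Lemma circ_sep f : Emb3 circ f -> Emb4 sep f.
Proof.
move=> [fi fc]; split=> // x y z t; rewrite /sep.
by case/orP=> /andP[/fc -> /fc ->]; rewrite ?orbT.
Qed.

Lemma oppr_sep : Emb4 sep (@GRing.opp rat).
Proof.
have cN x y z : circ (- x) (- y) (- z) = circ x z y.
  by rewrite /circ !lerN2; do 3!case: (_ <= _) => //=; do ?case: (_ <= _).
by split=> [x y /oppr_inj //|x y z t]; rewrite /sep !cN orbC.
Qed.

Lemma Emb3_comp (R : rat -> rat -> rat -> bool) f g :
  Emb3 R f -> Emb3 R g -> Emb3 R (f \o g).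
Proof. by move=> [fi fR] [gi gR]; split=> [x y /fi/gi|x y z /gR/fR]. Qed.

Lemma Emb4_comp (R : rat -> rat -> rat -> rat -> bool) f g :
  Emb4 R f -> Emb4 R g -> Emb4 R (f \o g).
Proof. by move=> [fi fR] [gi gR]; split=> [x y /fi/gi|x y z t /gR/fR]. Qed.

(** Here [mon p q] says that [f] keeps the order of [p] and [q]. Betweenness makes [mon] constant on
    the pairs of a triple, and any two pairs are linked through a pair sharing a point with each. *)
Lemma monotone_on (D : set rat) (f : rat -> rat) : injective f ->
  (forall x y z, D x -> D y -> D z -> x < y -> y < z -> betw (f x) (f y) (f z)) ->
  (forall x y, D x -> D y -> x < y -> f x < f y) \/
  (forall x y, D x -> D y -> x < y -> f y < f x).
Proof.
move=> fi fb; pose mon p q := (p < q) == (f p < f q).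
have ne x y : x != y -> f x != f y by apply: contra_neq => /fi.
have tot (x y : rat) : x != y -> (y < x) = ~~ (x < y).
  by move=> xy; case: ltgtP xy.
have monC p q : p != q -> mon p q = mon q p.
  by move=> pq; rewrite /mon (tot p q) // (tot (f p)) ?ne // eqb_negLR negbK.
have H x y z : D x -> D y -> D z -> x < y -> y < z ->
    mon x y = mon y z /\ mon x y = mon x z.
  move=> Dx Dy Dz xy yz; have xz := lt_trans xy yz.
  have fxy := ne _ _ (negbT (lt_eqF xy)); have fyz := ne _ _ (negbT (lt_eqF yz)).
  rewrite /mon xy yz xz; move: (fb _ _ _ Dx Dy Dz xy yz).
  rewrite /betw !le_eqVlt ![f z == _]eq_sym ![f y == f x]eq_sym.
  rewrite (negPf fxy) (negPf fyz) /= => /orP[]/andP[h1 h2].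
    by rewrite h1 h2 (lt_trans h1 h2).
  by rewrite (lt_gtF h1) (lt_gtF h2) (lt_gtF (lt_trans h1 h2)).
have L p q r : D p -> D q -> D r -> p != q -> p != r -> mon p q = mon p r.
  move=> Dp Dq Dr pq pr; case: (ltgtP q r) => [qr|rq|->//].
    case: (ltgtP p q) pq => // [pq _|qp _].
      by have [_ ->] := H _ _ _ Dp Dq Dr pq qr.
    case: (ltgtP p r) pr => // [pr _|rp _].
      by rewrite monC ?gt_eqF //; have [-> _] := H _ _ _ Dq Dp Dr qp pr.
    rewrite monC ?gt_eqF // [RHS]monC ?gt_eqF //.
    by have [h1 h2] := H _ _ _ Dq Dr Dp qr rp; rewrite -h2.
  case: (ltgtP p r) pr => // [pr _|rp _].
    by have [_ ->] := H _ _ _ Dp Dr Dq pr rq.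
  case: (ltgtP p q) pq => // [pq _|qp _].
    by rewrite [RHS]monC ?gt_eqF //; have [-> _] := H _ _ _ Dr Dp Dq rp pq.
  rewrite monC ?gt_eqF // [RHS]monC ?gt_eqF //.
  by have [h1 h2] := H _ _ _ Dr Dq Dp rq qp; rewrite -h1 h2.
have key p q r s : D p -> D q -> D r -> D s -> p != q -> r != s -> mon p q = mon r s.
  move=> Dp Dq Dr Ds pq rs; have [pr|pr] := eqVneq p r.
    by subst r; exact: L.
  by rewrite (L p q r) // monC // (L r p s) // eq_sym.
have [[a [b [Da Db ab mab]]]|H0] := pselect (exists a b, [/\ D a, D b, a != b & mon a b]).
  left=> x y Dx Dy xy; have : mon x y.
    by rewrite (key _ _ a b) // lt_eqF.
  by rewrite /mon xy => /eqP <-.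
right=> x y Dx Dy xy; have xy' := negbT (lt_eqF xy).
have : ~~ mon x y by apply/negP => m; apply: H0; exists x, y.
by rewrite /mon xy (tot (f x)) ?ne //; case: (_ < _).
Qed.

Lemma finite_extension_on (F : seq rat) (m : rat -> rat) :
  (forall x y, x \in F -> y \in F -> x < y -> m x < m y) ->
  exists g, aut g /\ forall x, x \in F -> g x = m x.
Proof.
move=> hm; have [|g [ag gs]] := @finite_extension [seq (x, m x) | x <- F].
  move=> p q /mapP[x xF ->] /mapP[y yF ->] /=.
  case: (ltgtP x y) => [xy|yx|->]; last by rewrite ltxx.
    by rewrite hm.
  by rewrite lt_gtF // hm.
exists g; split=> // x xF; apply: (gs (x, m x)); exact: map_f.
Qed.

Lemma decreasing_comp_aut (g h r : rat -> rat) a b : cancel g h -> cancel h g ->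
  (forall x y, x < y -> g y < g x) -> aut_on (itv (g b) (g a)) r ->
  aut_on (itv a b) (h \o r \o g).
Proof.
move=> gh hg gd Ar; have ar := aut_on_aut Ar.
have gE x y : (g x < g y) = (y < x).
  apply/idP/idP => [gxy|/gd//]; rewrite ltNge le_eqVlt; apply/negP.
  move=> /orP[/eqP e|/gd]; first by move: gxy; rewrite e ltxx.
  by rewrite lt_gtF.
split; first split.
- by move=> x y xy /=; rewrite -gE !hg aut_lt // gE.
- by exists (h \o inv r \o g); split=> x /=; rewrite hg ?invK ?invVK // gh.
- by move=> x nx /=; rewrite Ar.2 ?gh // /itv !gE andbC.
Qed.

Lemma increasing_comp_aut (g h r : rat -> rat) a b : cancel g h -> cancel h g ->
  (forall x y, x < y -> g x < g y) -> aut_on (itv (g a) (g b)) r ->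
  aut_on (itv a b) (h \o r \o g).
Proof.
move=> gh hg gi Ar; have ag : aut g by split=> //; exists h.
have -> : h = inv g by apply/funext => x; rewrite -[x in RHS]hg invK.
have [ar aig] := (aut_on_aut Ar, aut_inv ag); split; first by do 2?apply: aut_comp => //.
by move=> x nx /=; rewrite Ar.2 ?invK // /itv !aut_lt.
Qed.

Lemma betw_reconstructible : reconstructible (Emb3 betw).
Proof.
have dich f : Emb3 betw f -> (forall x y, x < y -> f x < f y) \/
    (forall x y, x < y -> f y < f x).
  move=> [fi fb]; have [x y z _ _ _ xy yz|H|H] := @monotone_on (fun=> True) f fi.
  - by apply: fb; rewrite /betw (ltW xy) (ltW yz).
  - by left=> x y; exact: H.
  - by right=> x y; exact: H.
split.
- by move=> f [].
- exact: Emb3_comp.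
- exact: increasing_betw.
- move=> Omega act w [act1 actM].
  have aM f : aut f -> Emb3 betw f by move=> [/increasing_betw].
  have [|F0 F0P] := @small_index Omega act _ w.
    by split=> // f g u /aM Mf /aM Mg; exact: actM.
  (* Fixing 0 and 1 excludes decreasing units. *)
  exists [:: 0, 1 & F0] => g h [Mg _ gh hg] gF.
  have g0 : g 0 = 0 by apply: gF; rewrite inE eqxx.
  have g1 : g 1 = 1 by apply: gF; rewrite !inE eqxx orbT.
  apply: F0P => [|x xF]; last by apply: gF; rewrite !inE xF !orbT.
  split; last by exists h.
  by case: (dich _ Mg) => // /(_ 0 1 isT); rewrite g0 g1.
- move=> m F /dich [mi|md].
    have [|g [ag gm]] := @finite_extension_on F m; first by move=> x y _ _; exact: mi.
    exists g, (inv g); split=> //; split; [| |exact: invK|exact: invVK].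
      exact: increasing_betw ag.1.
    exact: increasing_betw (aut_inv ag).1.
  have [|g [ag gm]] := @finite_extension_on F (fun x => - m x).
    by move=> x y _ _ /md; rewrite ltrN2.
  exists (-%R \o g), (inv g \o -%R); split; last by move=> x xF /=; rewrite gm ?opprK.
  split.
  - exact: Emb3_comp oppr_betw (increasing_betw ag.1).
  - exact: Emb3_comp (increasing_betw (aut_inv ag).1) oppr_betw.
  - by move=> x /=; rewrite opprK invK.
  - by move=> x /=; rewrite invVK ?opprK.
- move=> g h a b x [Mg Mh gh hg] /andP[ax xb]; case: (dich _ Mg) => [gi|gd].
    exists (g a), (g b); split; first by rewrite /itv !gi.
    by move=> r; exact: increasing_comp_aut.
  exists (g b), (g a); split; first by rewrite /itv !gd.
  by move=> r; exact: decreasing_comp_aut.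
Qed.

(* [b] exchanges the halves of [rat], seen as an ordered sum of two copies of
   [rat]; [p] and [p'] are the zeros of these copies. *)
Lemma rotation : exists b p p', [/\ Emb3 circ b, cancel b b, p < p', b p = p' &
  [/\ forall x, x < p -> p < b x < p' & forall x, p' < x -> p < b x < p']].
Proof.
have up (x : rat) : x < x + 1 by lra.
have down (x : rat) : x - 1 < x by lra.
have mid (x y : rat) : x < y -> x < (x + y) / 2 /\ (x + y) / 2 < y by lra.
pose T := (bool *l rat)%type.
have ltT (x y : T) : (x < y)%O = (x.1 < y.1)%O || ((x.1 == y.1) && (x.2 < y.2)).
  case: x y => [x1 x2] [y1 y2]; rewrite ltxi_pair /=.
  by case: x1; case: y1.
have satT : saturated T.
  apply: (@dense_saturated _ T (false, 0)) => [[x1 x2] [y1 y2]|[x1 x2]|[x1 x2]].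
  - rewrite ltT /= => /orP[xy|/andP[/eqP-> xy]].
      by exists (x1, x2 + 1); rewrite !ltT /= xy eqxx up orbT.
    by exists (y1, (x2 + y2) / 2); rewrite !ltT /= eqxx ltxx /=; exact: mid.
  - by exists (x1, x2 + 1); rewrite ltT /= eqxx up orbT.
  - by exists (x1, x2 - 1); rewrite ltT /= eqxx down orbT.
pose enumT n : T := odflt (false, 0) (unpickle n : option (bool * rat)).
have enumTP x : exists n, enumT n = x.
  by exists (pickle (x : bool * rat)); rewrite /enumT pickleK.
have [| |th [th' [thK thVK thi _ _]]] := @back_and_forth _ _ rat T enum_rat enumT [::]
    (fun _ _ => True) rat_saturated satT enum_ratP enumTP.
- by [].
- by move=> _ s os _; exists [::].
have thE x y : (x < y) = (th x < th y)%O.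
  apply/idP/idP => [/thi //|xy]; rewrite ltNge le_eqVlt; apply/negP => /orP[/eqP e|/thi].
    by move: xy; rewrite e ltxx.
  by rewrite lt_gtF.
pose sw (p : T) : T := (~~ p.1, p.2).
have swK : cancel sw sw by case=> x y; rewrite /sw /= negbK.
pose b x := th' (sw (th x)).
have thb x : th (b x) = sw (th x) by rewrite /b thVK.
have bK : cancel b b by move=> x; rewrite /b thVK swK thK.
pose s x := (th x).1.
(* The exchange reverses the order of points in different halves and keeps it within a half. *)
have cross x y : s x != s y -> (x <= y) = ~~ s x /\ (b x <= b y) = s x.
  by rewrite !leNgt !thE !thb !ltT /sw /s /=; case: (th x).1; case: (th y).1.
have same x y : s x = s y -> (b x <= b y) = (x <= y).
  by rewrite !leNgt !thE !thb !ltT /sw /s /= => ->; case: (th y).1.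
exists b, (th' (false, 0)), (th' (true, 0)); split=> //.
- split=> [x y /(can_inj bK) //|x y z].
  rewrite /circ; case: (eqVneq (s x) (s y)) => xy; case: (eqVneq (s y) (s z)) => yz.
  + have zx : s z = s x by rewrite xy yz.
    by rewrite !same.
  + have zx : s z != s x by rewrite xy eq_sym.
    have [yz1 yz2] := cross _ _ yz; have [zx1 zx2] := cross _ _ zx.
    rewrite (same _ _ xy) yz1 yz2 zx1 zx2; move: yz.
    by case: (s y); case: (s z); case: (x <= y) => //=; rewrite ?andbT ?andbF ?orbT ?orbF.
  + have zx : s z != s x by rewrite -yz eq_sym.
    have [xy1 xy2] := cross _ _ xy; have [zx1 zx2] := cross _ _ zx.
    rewrite (same _ _ yz) xy1 xy2 zx1 zx2 -yz; move: xy.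
    by case: (s x); case: (s y); case: (y <= z) => //=; rewrite ?andbT ?andbF ?orbT ?orbF.
  + have zx : s z = s x by move: xy yz; case: (s x); case: (s y); case: (s z).
    have [xy1 xy2] := cross _ _ xy; have [yz1 yz2] := cross _ _ yz.
    rewrite (same _ _ zx) xy1 xy2 yz1 yz2; move: xy.
    by case: (s x); case: (s y); case: (z <= x) => //=; rewrite ?andbT ?andbF ?orbT ?orbF.
- by rewrite thE !thVK ltT.
- by rewrite /b thVK.
- split=> x; rewrite !thE thb !thVK !ltT /sw /=; case: (th x) => -[] y //=.
  by rewrite andbT.
Qed.

(** For two points between the fixed points [p] and [p'], separation by these endpoints tells which
    of the two is smaller. *)
Lemma sep_fix_increasing (k : rat -> rat) p p' : Emb4 sep k -> p < p' ->
  (forall x, ~ itv p p' x -> k x = x) -> forall x y, x < y -> k x < k y.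
Proof.
move=> [ki ks] pp' kfix.
have kitv x : itv p p' x -> itv p p' (k x).
  move=> xp; apply: contrapT => nk; have /ki e := kfix _ nk.
  by rewrite e in nk.
have kp : k p = p by apply: kfix; rewrite /itv ltxx.
have kp' : k p' = p' by apply: kfix; rewrite /itv ltxx andbF.
move=> x y xy; have [xp|xp] := pselect (itv p p' x); have [yp|yp] := pselect (itv p p' y).
- have := kitv _ xp; have := kitv _ yp; move: xp yp; rewrite /itv => xp yp kyp kxp.
  have : sep p y x p' by rewrite /sep /circ; lra.
  move=> /ks; rewrite kp kp' /sep /circ => h.
  have : k x != k y by apply: contra_ltN xy => /eqP/ki ->.
  by lra.
- rewrite (kfix _ yp); have := kitv _ xp; move: xp yp; rewrite /itv; lra.
- rewrite (kfix _ xp); have := kitv _ yp; move: xp yp; rewrite /itv; lra.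
- by rewrite !kfix.
Qed.

(** A map fixing [p] and [p'] could still exchange the two arcs between them; the third fixed point
    [e] rules this out. *)
Lemma sep_itv (g : rat -> rat) p p' e : Emb4 sep g -> p < p' -> e < p ->
  g p = p -> g p' = p' -> g e = e ->
  (forall x, itv p p' x -> itv p p' (g x)) /\
  (forall x y, itv p p' x -> itv p p' y -> x < y -> g x < g y).
Proof.
move=> [gi gs] pp' ep gp gp' ge.
have gitv x : itv p p' x -> itv p p' (g x).
  rewrite /itv => xp; have : sep p p' x e by rewrite /sep /circ; lra.
  move=> /gs; rewrite gp gp' ge /sep /circ => h.
  have : g x != p by rewrite -gp; apply/eqP => /gi xe; lra.
  have : g x != p' by rewrite -gp'; apply/eqP => /gi xe; lra.
  lra.
split=> // x y /[dup] xp /gitv kxp /[dup] yp /gitv kyp xy.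
move: xp yp kxp kyp; rewrite /itv => xp yp kxp kyp.
have : sep p y x p' by rewrite /sep /circ; lra.
move=> /gs; rewrite gp gp' /sep /circ => h.
have : g x != g y by apply: contra_ltN xy => /eqP/gi ->.
by lra.
Qed.

(** * Monoids between the embeddings of [circ] and those of [sep] *)

Section CircularMonoid.
Variable M : set (rat -> rat).
Hypotheses (MS : forall f, M f -> Emb4 sep f) (CM : forall f, Emb3 circ f -> M f).
Hypothesis MM : forall f g, M f -> M g -> M (f \o g).

Lemma circular_aut f : aut f -> M f.
Proof. by case=> fi _; apply/CM/increasing_circ. Qed.

Lemma circular_local g h a b x : is_unit M g h -> itv a b x ->
  exists a' b', itv a' b' (g x) /\
    forall r, aut_on (itv a' b') r -> aut_on (itv a b) (h \o r \o g).
Proof.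
move=> [Mg Mh gh hg] /andP[ax xb].
have [gi gs] := MS Mg.
have gax : g a != g x by apply/eqP => /gi e; lra.
have gab : g a != g b by apply/eqP => /gi e; lra.
have gbx : g b != g x by apply/eqP => /gi e; lra.
have [|a' [la ua]] := @rat_saturated [seq z <- [:: g a; g b] | z < g x] [:: g x].
  by move=> l u; rewrite mem_filter => /andP[lx _]; rewrite inE => /eqP->.
have [|b' [lb ub]] := @rat_saturated [:: g x] [seq z <- [:: g a; g b] | g x < z].
  by move=> l u; rewrite inE => /eqP->; rewrite mem_filter => /andP[].
have a'x : a' < g x by apply: ua; rewrite inE.
have xb' : g x < b' by apply: lb; rewrite inE.
exists a', b'; split; first by rewrite /itv a'x.
have out z : z \in [:: g a; g b] -> (g x < z -> b' < z) /\ (z < g x -> z < a').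
  by move=> zab; split=> h'; [apply: ub|apply: la]; rewrite mem_filter h'.
have [oa1 oa2] := out (g a) (mem_head _ _).
have [|ob1 ob2] := out (g b); first by rewrite !inE eqxx orbT.
have ga' : g a < a' \/ b' < g a.
  by move: gax; rewrite neq_lt => /orP[/oa2|/oa1]; [left|right].
have gb' : g b < a' \/ b' < g b.
  by move: gbx; rewrite neq_lt => /orP[/ob2|/ob1]; [left|right].
(* If [h y] were outside [(a, b)], then [a] and [b] would separate it from [x], whereas neither
   [g a] nor [g b] lies between [y] and [g x]. *)
have hin y : itv a' b' y -> itv a b (h y).
  move=> /andP[h1 h2]; rewrite /itv; apply/negPn/negP => nh.
  have ya : h y != a.
    by apply/eqP => e; move: h1 h2; rewrite -[y]hg e; lra.
  have yb : h y != b.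
    by apply/eqP => e; move: h1 h2; rewrite -[y]hg e; lra.
  have : sep a b x (h y) by rewrite /sep /circ; lra.
  move=> /gs; rewrite hg /sep /circ => H.
  by clear -gab ga' gb' h1 h2 a'x xb' H; case: ga'; case: gb'; lra.
move=> r Ar; have ar := aut_on_aut Ar.
have fixo z : ~ itv a b z -> (h \o r \o g) z = z.
  by move=> nz /=; rewrite Ar.2 ?gh // => /hin; rewrite gh.
have Mk : M (h \o r \o g) by apply: MM => //; apply: MM => //; exact: circular_aut.
split=> //; split.
  by apply: sep_fix_increasing (MS Mk) (lt_trans ax xb) fixo.
by exists (h \o inv r \o g); split=> z /=; rewrite hg ?invK ?invVK // gh.
Qed.

(* A unit fixing enough points is the product of an automorphism of the order
   and of a conjugate of such an automorphism by the rotation [b]. *)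
Lemma circular_small_index (Omega : countType) (act : (rat -> rat) -> Omega -> Omega) w :
  monoid_action M act -> exists F : seq rat, forall g h, is_unit M g h ->
    (forall x, x \in F -> g x = x) -> act g w = w.
Proof.
move=> [act1 actM].
have [b [p [p' [cb bK pp' bp [blo bhi]]]]] := rotation.
have bp' : b p' = p by rewrite -bp bK.
have Mb := CM cb.
have actP : action act.
  by split=> // f g u /circular_aut Mf /circular_aut Mg; exact: actM.
have Mconj r : aut r -> M (b \o r \o b).
  by move=> /circular_aut Mr; exact: MM (MM Mb Mr) Mb.
(* Conjugation by the involution [b] gives a second action, whose supports control maps living
   outside [(p, p')]. The point [p - 1] added below serves as the third fixed point in [sep_itv]. *)
have actP' : action (fun r => act (b \o r \o b)).
  split=> [u|f g u af ag].
    by rewrite (_ : b \o idfun \o b = idfun) // funeqE => x /=; rewrite bK.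
  rewrite -actM; [|exact: Mconj|exact: Mconj].
  by congr act; apply/funext => x /=; rewrite bK.
have [F0 F0P] := small_index actP w; have [F1 F1P] := small_index actP' w.
exists [:: p, p', p - 1 & F0 ++ map b F1] => g h [Mg Mh gh hg] gF.
have hF x : x \in [:: p, p', p - 1 & F0 ++ map b F1] -> h x = x.
  by move=> xF; rewrite -[x in LHS]gF // gh.
have [i1 i2 i3] : [/\ p \in [:: p, p', p - 1 & F0 ++ map b F1],
    p' \in [:: p, p', p - 1 & F0 ++ map b F1] &
    p - 1 \in [:: p, p', p - 1 & F0 ++ map b F1]].
  by rewrite !inE !eqxx !orbT.
have ep : p - 1 < p by lra.
have [gitv gincr] := sep_itv (MS Mg) pp' ep (gF _ i1) (gF _ i2) (gF _ i3).
have [hitv hincr] := sep_itv (MS Mh) pp' ep (hF _ i1) (hF _ i2) (hF _ i3).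
pose cut (k : rat -> rat) x := if p < x < p' then k x else x.
have cutI k x : itv p p' x -> cut k x = k x by rewrite /cut /itv => ->.
have cutO k x : ~ itv p p' x -> cut k x = x by rewrite /cut /itv => /negP/negPf ->.
have cutK k k' : (forall x, itv p p' x -> itv p p' (k x)) -> cancel k k' ->
    cancel (cut k) (cut k').
  move=> kitv kk' x; have [xp|xp] := pselect (itv p p' x); last by rewrite !cutO.
  by rewrite [cut k x]cutI // cutI ?kk' //; exact: kitv.
have ag1 : aut (cut g).
  split; last by exists (cut h); split; exact: cutK.
  move=> x y xy; have [xp|xp] := pselect (itv p p' x); have [yp|yp] := pselect (itv p p' y).
  - by rewrite !cutI // gincr.
  - rewrite cutI // cutO //; have := gitv _ xp; move: xp yp; rewrite /itv; lra.
  - rewrite cutO // cutI //; have := gitv _ yp; move: xp yp; rewrite /itv; lra.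
  - by rewrite !cutO.
have ai := aut_inv ag1.
(* [cut g] is the part of [g] inside [(p, p')]. The rest [g2] fixes this interval, into which [b]
   maps the points outside [[p, p']], so [k] is the identity outside and hence increasing. *)
pose g2 := inv (cut g) \o g; pose k := b \o g2 \o b.
have Mg2 : M g2 by apply: MM => //; exact: circular_aut.
have Mk : M k by exact: MM (MM Mb Mg2) Mb.
have g2in x : itv p p' x -> g2 x = x by move=> xp; rewrite /g2 /= -(cutI g x xp) invK.
have invO x : ~ itv p p' x -> inv (cut g) x = x.
  by move=> nx; rewrite -[x in LHS](cutO g x nx) invK.
have npp : ~ itv p p' p by rewrite /itv ltxx.
have npp' : ~ itv p p' p' by rewrite /itv ltxx andbF.
have g2p : g2 p = p by rewrite /g2 /= gF // invO.
have g2p' : g2 p' = p' by rewrite /g2 /= gF // invO.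
have kfix x : ~ itv p p' x -> k x = x.
  move=> nx; suff e : g2 (b x) = b x by rewrite /k /= e bK.
  case: (ltgtP x p) => [/blo|px|->]; [exact: g2in| |by rewrite bp].
  case: (ltgtP x p') => [xp|/bhi|->]; [|exact: g2in|by rewrite bp'].
  by case: nx; rewrite /itv px.
have g2E : g2 = b \o k \o b by apply/funext => x; rewrite /k /= !bK.
have ak : aut k.
  split; first exact: sep_fix_increasing (MS Mk) pp' kfix.
  exists (b \o (h \o cut g) \o b); split=> x; rewrite /k /g2 /= bK.
    by rewrite invVK // gh bK.
  by rewrite hg invK // bK.
have -> : g = cut g \o g2 by apply/funext => x; rewrite /g2 /= invVK.
rewrite actM //; last exact: circular_aut.
have -> : act g2 w = w.
  rewrite g2E; apply: (F1P k ak) => x xF.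
  suff e : g2 (b x) = b x by rewrite /k /= e bK.
  have [xp|xp] := pselect (itv p p' (b x)); first exact: g2in.
  by rewrite /g2 /= gF ?invO // !inE mem_cat map_f ?orbT.
apply: (F0P _ ag1) => x xF; have [xp|xp] := pselect (itv p p' x); last exact: cutO.
by rewrite cutI // gF // !inE mem_cat xF !orbT.
Qed.

(** Stretch a gap just below [e] to [(p, p')], with [e] at [p']. The rotation sends [e] to [p] and
    all other points of [F] above [p]. *)
Lemma rotate_min (F : seq rat) e : exists c d, [/\ is_unit M c d, Emb3 circ c &
  forall x, x \in F -> x != e -> c e < c x].
Proof.
have [b [p [p' [cb bK pp' bp [blo bhi]]]]] := rotation.
have bp' : b p' = p by rewrite -bp bK.
have [|e' [le ue]] := @rat_saturated [seq x <- F | x < e] [:: e].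
  by move=> l u; rewrite mem_filter => /andP[lx _]; rewrite inE => /eqP->.
have e'e : e' < e by apply: ue; rewrite inE.
have [|s [as_ sE]] := @finite_extension [:: (e', p); (e, p')].
  by move=> x y; rewrite !inE => /orP[]/eqP-> /orP[]/eqP-> /=;
    rewrite ?ltxx ?e'e ?pp' // (lt_gtF e'e) (lt_gtF pp').
have se' : s e' = p by apply: (sE (e', p)); rewrite inE eqxx.
have se : s e = p' by apply: (sE (e, p')); rewrite !inE eqxx orbT.
have cc : Emb3 circ (b \o s) by apply: Emb3_comp => //; exact: increasing_circ as_.1.
exists (b \o s), (inv s \o b); split=> //.
- split; first exact: CM.
  + by apply: MM (CM cb); exact/circular_aut/aut_inv.
  + by move=> x /=; rewrite bK invK.
  + by move=> x /=; rewrite invVK ?bK.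
- move=> x xF xe /=; rewrite se bp'; case: (ltgtP x e) xe => // [xe _|ex _].
    have xe' : x < e' by apply: le; rewrite mem_filter xe.
    by have /blo/andP[] : s x < p by rewrite -se' aut_lt.
  by have /bhi/andP[] : p' < s x by rewrite -se aut_lt.
Qed.

Lemma circular_dense_reduction m (F : seq rat) :
  (exists c d, is_unit M c d /\
     forall x y, x \in F -> y \in F -> x < y -> c (m x) < c (m y)) ->
  exists g h, is_unit M g h /\ forall x, x \in F -> g x = m x.
Proof.
move=> [c [d [[Mc Md cd dc] cm]]].
have [g [ag gm]] := @finite_extension_on F (c \o m) cm.
have aig := aut_inv ag.
exists (d \o g), (inv g \o c); split; last by move=> x xF; rewrite /= gm //= cd.
split.
- by apply: MM => //; exact: circular_aut.
- by apply: MM => //; exact: circular_aut.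
- by move=> x /=; rewrite dc invK.
- by move=> x /=; rewrite invVK ?cd.
Qed.

Lemma circular_min m (F : seq rat) : injective m -> F != [::] ->
  exists e c d, [/\ e \in F, forall x, x \in F -> e <= x, is_unit M c d,
    Emb3 circ c & forall x, x \in F -> x != e -> c (m e) < c (m x)].
Proof.
move=> mi F0; have [e0|[e eF emin]] := min_seq F; first by rewrite e0 in F0.
have [c [d [cd cc cmin]]] := rotate_min (map m F) (m e).
exists e, c, d; split=> // x xF xe; apply: cmin; first exact: map_f.
by apply: contra_neq xe => /mi.
Qed.

(** After a rotation the least point [e] of [F] has the least image, and [circ e x y] then expresses
    the order of [x] and [y]. *)
Lemma circular_dense_circ m (F : seq rat) : Emb3 circ m ->
  exists g h, is_unit M g h /\ forall x, x \in F -> g x = m x.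
Proof.
move=> cm; have [->|F0] := eqVneq F [::].
  exists idfun, idfun; split=> //; split=> //; exact: circular_aut aut_id.
have [e [c [d [eF emin ucd cc cmin]]]] := circular_min cm.1 F0.
apply: circular_dense_reduction; exists c, d; split=> // x y xF yF xy.
have [xe|xe] := eqVneq x e; first by rewrite xe; apply: cmin => //; rewrite -xe gt_eqF.
have ex := emin _ xF; have /(Emb3_comp cc cm).2 /= : circ e x y.
  by rewrite /circ ex ltW.
have := cmin _ xF xe; have [ye|ye] := eqVneq y e; first by move: xy ex; rewrite ye; lra.
have := cmin _ yF ye; rewrite /circ => h1 h2 h3.
have : c (m x) != c (m y).
  by apply: contra_ltN xy => /eqP /(Emb3_comp cc cm).1 ->.
lra.
Qed.

Lemma circular_dense_sep m (F : seq rat) : M (@GRing.opp rat) -> Emb4 sep m ->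
  exists g h, is_unit M g h /\ forall x, x \in F -> g x = m x.
Proof.
move=> Mopp sm; have [->|F0] := eqVneq F [::].
  exists idfun, idfun; split=> //; split=> //; exact: circular_aut aut_id.
have [e [c [d [eF emin ucd cc cmin]]]] := circular_min sm.1 F0.
pose m' := c \o m; have sm' : Emb4 sep m' by exact: Emb4_comp (circ_sep cc) sm.
(* With the image of [e] least, separation of [e] and three further points amounts to betweenness of
   these three. *)
have [x y z|inc|dec] := @monotone_on (fun x => x \in F /\ x != e) m' sm'.1.
- move=> [xF xe] [yF ye] [zF ze] xy yz.
  have [hx hy hz] := And3 (cmin _ xF xe) (cmin _ yF ye) (cmin _ zF ze).
  have ex := emin _ xF; have /sm'.2 : sep e y x z by rewrite /sep /circ; lra.
  by rewrite /m' /= /sep /circ /betw; lra.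
- apply: circular_dense_reduction; exists c, d; split=> // x y xF yF xy.
  have [xe|xe] := eqVneq x e; first by rewrite xe; apply: cmin => //; rewrite -xe gt_eqF.
  apply: inc => //; split=> //; apply/eqP => ye.
  by have := emin _ xF; rewrite leNgt -ye xy.
(* In the decreasing case the negated map is increasing except that the image of [e] is now
   greatest; a second rotation makes it least. *)
have [c2 [d2 [u2 cc2 c2min]]] := rotate_min [seq - m' x | x <- F] (- m' e).
have ne x : x \in F -> x != e -> - m' x != - m' e.
  by move=> xF; apply: contra_neq => /oppr_inj /sm'.1.
apply: circular_dense_reduction; exists (c2 \o (-%R \o c)), (d \o -%R \o d2); split.
  have [Mc Md cd dc] := ucd; have [Mc2 Md2 cd2 dc2] := u2.
  split.
  - by apply: MM => //; exact: MM.
  - by apply: MM => //; exact: MM.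
  - by move=> x /=; rewrite cd2 opprK cd.
  - by move=> x /=; rewrite dc opprK dc2.
move=> x y xF yF xy.
have [xe|xe] := eqVneq x e.
  rewrite /= xe; apply: c2min; first by apply/mapP; exists y.
  by apply: ne => //; rewrite -xe gt_eqF.
have ex : e < x by rewrite lt_neqAle eq_sym xe emin.
have ye : y != e by rewrite gt_eqF // (lt_trans ex).
have hx := c2min _ (map_f (fun x => - m' x) xF) (ne _ xF xe).
have hy := c2min _ (map_f (fun x => - m' x) yF) (ne _ yF ye).
have := dec _ _ (conj xF xe) (conj yF ye) xy; have := cmin _ yF ye; rewrite -/m' => h1 h2.
have : circ (- m' e) (- m' x) (- m' y).
  by move: h1 h2; rewrite /m' /circ /=; lra.
move=> /cc2.2; move: hx hy; rewrite /circ /= -/m' => hx hy h.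
have : c2 (- m' x) != c2 (- m' y).
  by apply: contra_ltN xy => /eqP /cc2.1 /oppr_inj /sm'.1 ->.
by move: hx hy h; rewrite /m' /=; lra.
Qed.

End CircularMonoid.

Lemma circ_reconstructible : reconstructible (Emb3 circ).
Proof.
split.
- by move=> f [].
- exact: Emb3_comp.
- exact: increasing_circ.
- exact: circular_small_index circ_sep (fun _ => id) (@Emb3_comp circ).
- by move=> m F; exact: circular_dense_circ (fun _ => id) (@Emb3_comp circ) _ _.
- exact: circular_local circ_sep (fun _ => id) (@Emb3_comp circ).
Qed.

Lemma sep_reconstructible : reconstructible (Emb4 sep).
Proof.
split.
- by move=> f [].
- exact: Emb4_comp.
- by move=> f /increasing_circ/circ_sep.
- exact: circular_small_index (fun _ => id) circ_sep (@Emb4_comp sep).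
- by move=> m F; exact: circular_dense_sep circ_sep (@Emb4_comp sep) _ _ oppr_sep.
- exact: circular_local (fun _ => id) circ_sep (@Emb4_comp sep).
Qed.

(** * Clones *)

Local Open Scope classical_set_scope.

Section PointwiseTopology.
Variables (A : choiceType) (n : nat).

(** Pointwise convergence with discrete values: finitely many arguments determine a basic
    neighbourhood. [{classic _}] supplies the equality needed for membership of functions in
    lists. *)
Lemma op_nbhsP (f : op A n) (U : set (op A n)) :
  nbhs f U <-> exists X : seq ('I_n -> A), forall g : op A n,
    (forall x, x \in (X : seq {classic ('I_n -> A)}) -> g x = f x) -> U g.
Proof.
pose F : set_system (op A n) := [set V | exists X : seq ('I_n -> A), forall g : op A n,
    (forall x, x \in (X : seq {classic ('I_n -> A)}) -> g x = f x) -> V g].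
have FF : Filter F.
  split.
  - by exists [::].
  - move=> V W [X XV] [Y YW]; exists (X ++ Y) => g gXY; split.
      by apply: XV => x xX; apply: gXY; rewrite mem_cat xX.
    by apply: YW => x xY; apply: gXY; rewrite mem_cat xY orbT.
  - by move=> V W VW [X XV]; exists X => g /XV /VW.
split.
  suff : F --> f by apply.
  apply/cvg_sup => x V [W [ [Q oQ <-] Qfx] QV].
  by apply: filterS QV _; exists [:: x] => g gx /=; rewrite gx ?inE.
move=> [X XU]; apply: filterS XU _; elim: X => [|x X IH].
  by apply: filterS filterT => g _ x.
have nx : nbhs f [set g : op A n | g x = f x].
  have /cvg_sup /(_ x) : nbhs f --> f by [].
  apply; exists ((fun g : op A n => g x) @^-1` [set f x]); split => //=.
  exists [set f x] => //; exact: discrete_open.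
apply: filterS2 nx IH => g gx gX y; rewrite inE => /orP[/eqP-> //|]; exact: gX.
Qed.

Lemma set_op_nbhsP (C : set (op A n)) (f : C) (U : set C) :
  (exists X : seq ('I_n -> A), forall g : C,
    (forall x, x \in (X : seq {classic ('I_n -> A)}) -> set_val g x = set_val f x) -> U g) <->
  nbhs f U.
Proof.
split=> [[X XU]|].
  have := (@initial_continuous C (op A n) set_val) f.
  move=> /(_ [set g | forall x, x \in (X : seq {classic ('I_n -> A)}) ->
    g x = set_val f x]).
  move=> H; apply: filterS XU _; apply: H; apply/op_nbhsP; by exists X.
move=> [V [ [Q oQ <-] Qf] QU].
have /op_nbhsP [X XQ] : nbhs (set_val f : op A n) Q by apply: open_nbhs_nbhs.
by exists X => g gX; apply: QU; exact: XQ.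
Qed.

End PointwiseTopology.

Lemma continuous_sum_map (A B : choiceType) (C : opset A) (D : opset B)
    (xi : forall n, C n -> D n) :
  (forall n (f : C n) y, exists X : seq ('I_n -> A), forall g : C n,
    (forall x, x \in (X : seq {classic ('I_n -> A)}) -> set_val g x = set_val f x) ->
    set_val (xi n g) y = set_val (xi n f) y) ->
  continuous (sum_map xi).
Proof.
move=> H [n f] U.
rewrite /nbhs /= /sigT_nbhs /= => /set_op_nbhsP [Y YU]; apply/set_op_nbhsP.
elim: Y U YU => [|y Y IH] U YU; first by exists [::] => g _; apply: YU.
have [X XY] := H n f y.
(* The auxiliary set postpones the condition at [y]: its elements have arity [n] and are in [U] once
   they agree at [y]. *)
have [|X' X'U] := IH [set d | exists e, d = existT _ n e /\
    (set_val e y = set_val (xi n f) y -> U d)].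
  move=> d dY; exists d; split=> // dy; apply: YU => x.
  by rewrite inE => /orP[/eqP->//|/dY].
exists (X ++ X') => g gX.
have [|e [/= /eqP]] := X'U g; first by move=> x xX; apply: gX; rewrite mem_cat xX orbT.
rewrite eq_Tagged /= => /eqP <-; apply; apply: XY => x xX.
by apply: gX; rewrite mem_cat xX.
Qed.

(** The operations on the right-hand side already form a clone, as [M] is a monoid. *)
Lemma clone_generatedP (A : choiceType) (M : set (A -> A)) n (f : op A n) :
  M idfun -> (forall g h, M g -> M h -> M (g \o h)) ->
  clone_generated M f <-> exists i m, M m /\ f = (fun x => m (x i)).
Proof.
move=> Mid MM; split=> [|[i [m [Mm ->]]] C [Cproj Ccomp] CM]; last first.
  exact: (Ccomp 1%N n (unary_op m) (fun=> proj_op i) (CM _ Mm) (fun=> Cproj _ i)).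
move=> /(_ (fun k => [set g | exists i m, M m /\ g = (fun x => m (x i))])).
apply; last by move=> h Mh; exists ord0, h.
split=> [k i|k l g h [i [m [Mm ->]]] hC]; first by exists i, idfun.
have [j [m' [Mm' e]]] := hC i; exists j, (m \o m'); split; first exact: MM.
by rewrite /comp_op e.
Qed.

Lemma reconstructible_automatic_homeomorphicity (M : set (rat -> rat)) :
  reconstructible M -> automatic_homeomorphicity (clone_generated M).
Proof.
move=> recM Omega D xi cloneD closedD [xi_bij xi_proj xi_comp].
have Mid : M idfun by apply: rec_incr recM _ _.
have MM := rec_comp recM.
pose C := clone_generated M.
have CP n (f : op rat n) : C n f <-> exists i m, M m /\ f = (fun x => m (x i)).
  exact: clone_generatedP.
have elt n (f : op rat n) : C n f -> exists k : C n, set_val k = f.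
  by move=> Cf; exists (SigSub (mem_set Cf)).
have CE n (f : C n) : exists i m, M m /\ set_val f = (fun x => m (x i)).
  exact: (proj1 (CP n _) (set_valP f)).
have Cunary m : M m -> C 1%N (unary_op m) by move=> Mm; apply/CP; exists ord0, m.
have /choice [U UE] : forall m, exists k : C 1%N, M m -> set_val k = unary_op m.
  move=> m; have [Mm|] := pselect (M m); first by have [k] := elt _ _ (Cunary _ Mm); exists k.
  by have [k _] := elt _ _ (Cunary _ Mid); exists k.
pose act m (w : Omega) : Omega := set_val (xi 1%N (U m)) (fun=> w).
have ord1E (B : choiceType) (x : 'I_1 -> B) : (fun=> x ord0) = x.
  by apply/funext => i; rewrite [i]ord1.
have xiE n (f : C n) i m : M m -> set_val f = (fun x => m (x i)) ->
    set_val (xi n f) = (fun y => act m (y i)).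
  move=> Mm fE.
  have [|P PE] := elt n (proj_op i); first by apply/CP; exists i, idfun.
  have -> := xi_comp 1%N n (U m) (fun=> P) f.
    by apply/funext => y; rewrite /comp_op (xi_proj _ _ _ PE).
  by rewrite fE (UE _ Mm) PE.
have actP : monoid_action M act.
  split=> [w|f g w Mf Mg].
    by rewrite /act (xi_proj _ ord0) // (UE _ Mid).
  have -> : act (f \o g) w = comp_op (set_val (xi 1%N (U f)))
      (fun=> set_val (xi 1%N (U g))) (fun=> w).
    rewrite /act (xi_comp _ _ (U f) (fun=> U g)) //.
    by rewrite (UE _ (MM _ _ Mf Mg)) (UE _ Mf) (UE _ Mg).
  by [].
have xi_inj n : injective (xi n) by exact: bij_inj.
have act_inj f g : M f -> M g -> (forall w, act f w = act g w) -> f = g.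
  move=> Mf Mg fg; suff : U f = U g.
    move=> /(congr1 set_val); rewrite (UE _ Mf) (UE _ Mg) => e.
    by apply/funext => x; have := congr1 (fun h => h (fun=> x)) e.
  apply: xi_inj; apply: val_inj; apply/funext => x.
  by rewrite -[x](ord1E Omega); exact: fg.
have act_closed (k : Omega -> Omega) :
    (forall W : seq Omega, exists f, M f /\ forall w, w \in W -> act f w = k w) ->
    exists f, M f /\ forall w, act f w = k w.
  (* An operation that the image approximates on every finite set of points lies in the closed set
     [D], and so comes from an element of [M]. *)
  move=> kW; have Dk : D 1%N (unary_op k).
    have := closedD (existT _ 1%N (unary_op k)); apply => B.
    move=> /op_nbhsP [X XB]; have [f [Mf fk]] := kW [seq x ord0 | x <- X].
    exists (existT _ 1%N (set_val (xi 1%N (U f)))); split; first exact: set_valP.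
    apply: XB => x xX; rewrite -[x in LHS](ord1E Omega); apply: fk.
    exact: (map_f (fun x : {classic ('I_1 -> Omega)} => x ord0) xX).
  pose d : D 1%N := SigSub (mem_set Dk).
  have [xi' xiK xiVK] := xi_bij 1%N; have [i [m [Mm mE]]] := CE _ (xi' d).
  exists m; split=> // w; have := xiE _ _ _ _ Mm mE; rewrite xiVK.
  by move=> /(congr1 (fun h => h (fun=> w))).
have cont := act_continuous recM actP act_inj act_closed.
have opn := act_open recM actP act_inj act_closed.
(* Needed to recover the coordinate on which an operation depends. If [m] acted as a constant, [m]
   and its composite with a translation would act alike, against faithfulness and injectivity. *)
have nonconst m : M m -> exists w1 w2, act m w1 <> act m w2.
  move=> Mm; apply: contrapT => /forallNP H.
  have Mt : M (fun x => x + 1) by apply: (rec_incr recM) => x y; lra.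
  have e : m \o (fun x => x + 1) = m.
    apply: act_inj => // [|w]; first exact: MM.
    have /forallNP/(_ w)/contrapT <- := H (act (fun x => x + 1) w).
    exact: actP.2.
  have := congr1 (fun f => f 0) e => /= /(rec_inj recM Mm); lra.
have xi_can n : exists g : D n -> C n, cancel (xi n) g /\ cancel g (xi n).
  by have [g gK gVK] := xi_bij n; exists g.
pose xi' n : D n -> C n := projT1 (cid (xi_can n)).
have xiK n : cancel (xi n) (xi' n) by rewrite /xi'; case: (cid _) => g [].
have xiVK n : cancel (xi' n) (xi n) by rewrite /xi'; case: (cid _) => g [].
exists (sum_map xi'); split.
- by move=> [n f]; rewrite /sum_map /= xiK.
- by move=> [n f]; rewrite /sum_map /= xiVK.
- apply: continuous_sum_map => n f y; have [i [m [Mm fE]]] := CE _ f.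
  have [F FE] := cont (y i).
  (* The first two arguments detect the coordinate, since [m'] is injective; the constant ones test
     the values on [F]. *)
  exists [:: (fun=> 1), (fun l => if l == i then 1 else 0) & [seq (fun=> q) | q <- F]].
  move=> g gX; have [j [m' [Mm' gE]]] := CE _ g.
  have gf x : x \in ([:: (fun=> 1), (fun l => if l == i then 1 else 0) &
      [seq (fun=> q) | q <- F]] : seq {classic ('I_n -> rat)}) -> m' (x j) = m (x i).
    by move=> /gX; rewrite gE fE.
  have ji : j = i.
    have e1 := gf (fun=> 1) (mem_head _ _).
    have := gf (fun l => if l == i then 1 else 0) ltac:(by rewrite !inE eqxx orbT).
    rewrite eqxx -e1 => /(rec_inj recM Mm'); by case: eqVneq.
  rewrite (xiE _ _ _ _ Mm fE) (xiE _ _ _ _ Mm' gE) ji; apply: FE => // q qF.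
  apply: (gf (fun=> q)); rewrite !inE; apply/or3P/Or33.
  exact: (map_f (fun q => (fun=> q) : {classic ('I_n -> rat)}) qF).
- apply: continuous_sum_map => n d y; have [i [m [Mm fE]]] := CE _ (xi' n d).
  have dE := xiE _ _ _ _ Mm fE; rewrite xiVK in dE.
  have [w1 [w2 w12]] := nonconst _ Mm; have [W WE] := opn (y i).
  (* If the coordinates differed, the third argument would give equal values of [act m] at [w1] and
     [w2]. *)
  exists [:: (fun=> w1), (fun=> w2), (fun l => if l == i then w1 else w2) &
    [seq (fun=> w) | w <- W]].
  move=> d' dX; have [j [m' [Mm' gE]]] := CE _ (xi' n d').
  have d'E := xiE _ _ _ _ Mm' gE; rewrite xiVK in d'E.
  have dd x : x \in ([:: (fun=> w1), (fun=> w2), (fun l => if l == i then w1 else w2) &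
      [seq (fun=> w) | w <- W]] : seq {classic ('I_n -> Omega)}) ->
      act m' (x j) = act m (x i).
    by move=> /dX; rewrite dE d'E.
  have ji : j = i.
    have e2 := dd (fun=> w2) ltac:(by rewrite !inE eqxx orbT).
    have := dd (fun l => if l == i then w1 else w2) ltac:(by rewrite !inE eqxx !orbT).
    by rewrite eqxx; case: eqVneq => // _; rewrite e2 => /esym.
  rewrite fE gE ji; apply/esym; apply: WE => // w wW; apply/esym.
  apply: (dd (fun=> w)); rewrite !inE; apply/or4P/Or44.
  exact: (map_f (fun w => (fun=> w) : {classic ('I_n -> Omega)}) wW).
Qed.

Theorem theorem6p3 :
  automatic_homeomorphicity (clone_generated (Emb3 betw)) /\
  automatic_homeomorphicity (clone_generated (Emb3 circ)) /\
  automatic_homeomorphicity (clone_generated (Emb4 sep)).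
Proof.
split; first exact: reconstructible_automatic_homeomorphicity betw_reconstructible.
split; first exact: reconstructible_automatic_homeomorphicity circ_reconstructible.
exact: reconstructible_automatic_homeomorphicity sep_reconstructible.
Qed.
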